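(* Let $G$ be an infinite finitely generated group of subexponential growth. For every finite set $S$ of generators of $G$ and every $\alpha\in[0,1]$, there exists a non-empty $G$-subshift $X\subset\{0,1\}^G$ with uniform density $\alpha$ (with respect to $S$).
   Context: $\{0,1\}^G$ carries the product topology and the shift action $(\sigma_g(x))_h=x_{g^{-1}h}$. A $G$-subshift is a closed subset of $\{0,1\}^G$ invariant under all $\sigma_g$, $g\in G$. For a finite generating set $S$, $d$ is the graph distance on the undirected right Cayley graph with vertex set $G$ and edges $\{g,gs\}$ ($g\in G,s\in S$), and $B(g,n)=\{h\in G\mid d(g,h)\le n\}$. For a finite non-empty $F\subset G$ and $x\in\{0,1\}^G$, $\operatorname{dens}(1,F,x)=\frac{|\{g\in F\mid x_g=1\}|}{|F|}$. A $G$-subshift $X\subset\{0,1\}^G$ has uniform density $\alpha$ (with respect to $S$) if for every $x\in X$ and every sequence $(g_n)_{n\in\mathbb N}$ of elements of $G$, $\operatorname{dens}(1,B(g_n,n),x)\to\alpha$ as $n\to\infty$. A finitely generated group has subexponential growth if $\lim_{n\to\infty}|B(1_G,n)|^{1/n}=1$. *)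

(* Defs.v *)
From mathcomp Require Import all_boot all_order all_algebra finmap.
From mathcomp Require Import all_classical all_reals all_analysis.

Set Implicit Arguments.
Unset Strict Implicit.
Unset Printing Implicit Defensive.

Import Order.TTheory GRing.Theory Num.Theory.
Import numFieldNormedType.Exports.

Local Open Scope classical_set_scope.
Local Open Scope fset_scope.
Local Open Scope ring_scope.

(* Boolean predicates lose no generality here: boolp makes every subset of G
   the support of a boolean predicate. *)
Definition generates (G : groupType) (S : {fset G}) : Prop :=
  forall H : {pred G}, group_closed H -> {subset S <= H} -> forall g, g \in H.

Definition finitely_generated (G : groupType) : Prop :=
  exists S : {fset G}, generates S.

Definition cayley_edge (G : groupType) (S : {fset G}) (g h : G) : Prop :=
  exists2 s, s \in S & (h = g * s \/ g = h * s)%g.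

Definition cayley_walk (G : groupType) (S : {fset G}) (g h : G) (n : nat)
    : Prop :=
  exists p : seq G,
    [/\ path (fun a b => `[< cayley_edge S a b >]) g p, last g p = h
      & size p = n].

(* The default value 0 of xget is returned only when g and h are not connected,
   which cannot happen when S generates G. *)
Definition cayley_dist (G : groupType) (S : {fset G}) (g h : G) : nat :=
  xget 0%N [set n | cayley_walk S g h n /\
                    forall m, cayley_walk S g h m -> (n <= m)%N].

Lemma cayley_walk_cat (G : groupType) (S : {fset G}) (g h k : G) (m n : nat) :
  cayley_walk S g h m -> cayley_walk S h k n -> cayley_walk S g k (m + n).
Proof.
move=> [p [pp lp sp]] [q [pq lq sq]]; exists (p ++ q); split.
- by rewrite cat_path pp lp pq.
- by rewrite last_cat lp.
- by rewrite size_cat sp sq.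
Qed.

Lemma cayley_walk_sym (G : groupType) (S : {fset G}) (g h : G) (n : nat) :
  cayley_walk S g h n -> cayley_walk S h g n.
Proof.
have symE a b : `[< cayley_edge S a b >] = `[< cayley_edge S b a >].
  by apply/asboolP/asboolP => -[s sS [] e]; exists s => //; [right|left|right|left].
move=> [p [pp lp sp]]; exists (rev (belast g p)); split.
- rewrite -lp rev_path; apply: sub_path pp => a b /=; by rewrite symE.
- by case: p lp {pp sp} => [//|a p] _ /=; rewrite rev_cons last_rcons.
- by rewrite size_rev size_belast.
Qed.

Lemma generates_connected (G : groupType) (S : {fset G}) :
  generates S -> forall g h, exists n, cayley_walk S g h n.
Proof.
move=> genS g h.
pose H : {pred G} := fun k => `[< forall a, exists n, cayley_walk S a (a * k)%g n >].
suff /asboolP /(_ g) : (g^-1 * h)%g \in H by rewrite mulVKg.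
apply: genS.
- split; first by apply/asboolP => a; exists 0%N, [::]; rewrite mulg1.
  move=> u v /asboolP uH /asboolP vH; apply/asboolP => a.
  have [m wm] := uH a; have [n] := vH (a * (u / v))%g.
  rewrite !mulgA mulgVK => /cayley_walk_sym wn.
  exists (m + n)%N; exact: cayley_walk_cat wm wn.
- move=> s sS; apply/asboolP => a; exists 1%N, [:: (a * s)%g]; split => //=.
  by rewrite andbT; apply/asboolP; exists s => //; left.
Qed.

Lemma cayley_dist_leP (G : groupType) (S : {fset G}) (g h : G) (n : nat) :
  generates S ->
  (cayley_dist S g h <= n)%N <-> exists2 m, (m <= n)%N & cayley_walk S g h m.
Proof.
move=> genS; rewrite /cayley_dist; case: xgetP => [m _ [wm minm]|none].
  split=> [mn|[k kn wk]]; first by exists m.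
  exact: leq_trans (minm _ wk) kn.
have [k wk] := generates_connected genS g h.
have ex : exists k, `[< cayley_walk S g h k >] by exists k; apply/asboolP.
case: (ex_minnP ex) => m /asboolP wm minm.
by case: (none m); split => // j wj; apply: minm; apply/asboolP.
Qed.

Lemma finite_cayley_walk (G : groupType) (S : {fset G}) (g : G) (n : nat) :
  finite_set [set h | cayley_walk S g h n].
Proof.
elim: n => [|n IHn].
  apply: (sub_finite_set _ (finite_set1 g)) => h [p [_ lp /size0nil p0]].
  by rewrite p0 in lp.
have fS := finite_fset S.
have f1 := finite_image2 (fun a s => a * s)%g IHn fS.
have f2 := finite_image2 (fun a s => a * s^-1)%g IHn fS.
move: (conj f1 f2); rewrite -finite_setU; apply: sub_finite_set => h [p [pp lp sp]].
case/lastP: p pp lp sp => [//|p b]; rewrite rcons_path last_rcons size_rcons.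
move=> /andP[pp /asboolP[s sS e]] eb [sp]; subst b.
have wn : cayley_walk S g (last g p) n by exists p.
case: e => e; [left|right]; exists (last g p) => //; exists s => //.
by rewrite e mulgK.
Qed.

(* fset_set returns the empty set on infinite sets; the balls are finite as soon
   as S generates G (see cayley_ballE). *)
Definition cayley_ball (G : groupType) (S : {fset G}) (g : G) (n : nat)
    : {fset G} :=
  fset_set [set h | (cayley_dist S g h <= n)%N].

Lemma cayley_ballE (G : groupType) (S : {fset G}) (g : G) (n : nat) :
  generates S ->
  forall h, (h \in cayley_ball S g n) = (cayley_dist S g h <= n)%N.
Proof.
move=> genS h; rewrite in_fset_set ?inE; first by apply/idP/idP; rewrite inE.
have fU : finite_set (\bigcup_(m in `I_n.+1) [set k | cayley_walk S g k m]).
  apply: bigcup_finite => // m _; exact: finite_cayley_walk.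
apply: sub_finite_set fU => k /= /(cayley_dist_leP _ _ _ genS)[m mn wm].
by exists m.
Qed.

(* By independence of the generating set, "some" and "every" S are equivalent
   here; "some" is formally the weaker property. *)
Definition subexponential_growth (R : realType) (G : groupType) : Prop :=
  exists2 S : {fset G}, generates S &
    ((#|` cayley_ball S 1%g n|%:R : R) `^ (n%:R^-1)) @[n --> \oo] --> (1 : R).

Definition dens (R : realType) (G : groupType) (a : bool) (F : {fset G})
    (x : G -> bool) : R :=
  #|` [fset g in F | x g == a]|%:R / #|` F|%:R.

Definition shift_action (G : groupType) (g : G) (x : {ptws G -> bool})
    : {ptws G -> bool} :=
  fun h => x (g^-1 * h)%g.

Definition subshift (G : groupType) (X : set {ptws G -> bool}) : Prop :=
  closed X /\ forall g x, X x -> X (shift_action g x).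

Definition uniform_density (R : realType) (G : groupType) (S : {fset G})
    (X : set {ptws G -> bool}) (alpha : R) : Prop :=
  forall x, X x -> forall g : nat -> G,
    dens R true (cayley_ball S (g n) n) x @[n --> \oo] --> alpha.

(* Main.v *)
Require Import Defs.
From mathcomp Require Import all_boot all_order all_algebra finmap.
From mathcomp Require Import all_classical all_reals all_analysis.
From mathcomp Require Import zify ring lra.

(** Balls in a group of subexponential growth are not known to be Foelner
    along all radii, so no boundary estimate is used.  Instead we build
    u : G -> R whose reduction modulo 1 is equidistributed on all large balls,
    and take x v = 1 iff u v lies in [0, alpha) modulo 1.

    u is a sum of fields phi_k, where phi_k is (1/L_k)-Lipschitz for a rapidly
    growing sequence L_k.  Each phi_k is obtained from the random field
    v |-> max_c (theta_c - d(c, v) / L_k), with theta_c independent, truncated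
    geometric plus uniform.  Memorylessness makes its value at v nearly uniform
    modulo 1; the truncation, which makes the dependence local, is affordable
    exactly because the growth is subexponential.  Large deviations on a ball B
    have probability exp(-c|B|), which beats both the number of dependent balls
    (a counting form of the local lemma) and the number of essentially different
    Lipschitz perturbations on B.  The latter allows phi_k to be chosen so that
    the estimate at level k holds for every sufficiently Lipschitz perturbation,
    in particular after adding phi_(k+1), phi_(k+2), ...  Compactness of
    {0,1}^G concludes, the subshift being the set of all configurations that
    satisfy the resulting explicit density bounds. *)

Set Implicit Arguments.
Unset Strict Implicit.
Unset Printing Implicit Defensive.

Import Order.TTheory GRing.Theory Num.Theory.
Import numFieldNormedType.Exports.

Local Open Scope classical_set_scope.
Local Open Scope fset_scope.
Local Open Scope ring_scope.

(** * Iterated expectation over independent coordinates *)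

Section IteratedExpectation.
Context {R : realType} {T : choiceType} {A : finType} (mu : A -> R).
Context (mu_ge0 : forall a, 0 <= mu a) (mu_sum1 : \sum_a mu a = 1).

Implicit Types (f : T -> A) (s : seq T) (F H : (T -> A) -> R).

Definition upd f (c : T) (a : A) : T -> A := fun x => if x == c then a else f x.

(* The coordinates in [s] are averaged out independently with law [mu], all
   others being frozen at their value in [f]. *)
Fixpoint Ex s F f : R :=
  if s is c :: s' then \sum_a mu a * Ex s' F (upd f c a) else F f.

Definition insens (U : Type) (c : T) (F : (T -> A) -> U) : Prop :=
  forall f a, F (upd f c a) = F f.

Lemma upd_same f c a b : upd (upd f c a) c b = upd f c b.
Proof. by apply/funext => x; rewrite /upd; case: eqP. Qed.

Lemma upd_comm f c d a b : c != d -> upd (upd f c a) d b = upd (upd f d b) c a.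
Proof.
move=> cd; apply/funext => x; rewrite /upd; case: (eqVneq x d) => // ->.
by rewrite eq_sym (negbTE cd).
Qed.

Lemma Ex_le s F H f : (forall g, F g <= H g) -> Ex s F f <= Ex s H f.
Proof.
move=> FH; elim: s f => [|c s IH] f //=.
by apply: ler_sum => a _; rewrite ler_wpM2l.
Qed.

Lemma eq_Ex s F H f : F =1 H -> Ex s F f = Ex s H f.
Proof. by move=> /funext ->. Qed.

Lemma Ex_cst s k f : Ex s (fun=> k) f = k.
Proof.
elim: s f => [|c s IH] f //=.
by rewrite (eq_bigr (fun a => mu a * k)) => [|a _]; rewrite ?IH // -mulr_suml mu_sum1 mul1r.
Qed.

Lemma ExD s F H f : Ex s (fun g => F g + H g) f = Ex s F f + Ex s H f.
Proof.
elim: s f => [|c s IH] f //=.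
by rewrite -big_split /=; apply: eq_bigr => a _; rewrite IH mulrDr.
Qed.

Lemma ExZ s k F f : Ex s (fun g => k * F g) f = k * Ex s F f.
Proof.
elim: s f => [|c s IH] f //=.
by rewrite mulr_sumr; apply: eq_bigr => a _; rewrite IH mulrCA.
Qed.

Lemma ExB s F H f : Ex s (fun g => F g - H g) f = Ex s F f - Ex s H f.
Proof.
rewrite (@eq_Ex _ _ (fun g => F g + -1 * H g)) => [|g]; last by rewrite mulN1r.
by rewrite ExD ExZ mulN1r.
Qed.

Lemma Ex_sum (I : Type) (r : seq I) (P : pred I) (F : I -> (T -> A) -> R) s f :
  Ex s (fun g => \sum_(i <- r | P i) F i g) f = \sum_(i <- r | P i) Ex s (F i) f.
Proof.
elim: r => [|i r IH].
  by rewrite big_nil (@eq_Ex _ _ (fun=> 0)) ?Ex_cst // => g; rewrite big_nil.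
rewrite big_cons -IH; case: ifP => Pi.
  by rewrite -ExD; apply: eq_Ex => g; rewrite big_cons Pi.
by apply: eq_Ex => g; rewrite big_cons Pi.
Qed.

Lemma Ex_ge0 s F f : (forall g, 0 <= F g) -> 0 <= Ex s F f.
Proof. by move=> F0; rewrite -(Ex_cst s 0 f); apply: Ex_le. Qed.

Lemma insens_Ex s F c : insens c F -> insens c (Ex s F).
Proof.
move=> iF; elim: s => [|d s IH] f a //=.
apply: eq_bigr => b _; congr (_ * _).
by case: (eqVneq c d) => [->|cd]; rewrite ?upd_same // upd_comm // IH.
Qed.

(** No coordinate influences both factors: when one is averaged, the factor insensitive to it leaves
    the sum. *)
Lemma Ex_indep s F H f :
  (forall c, insens c F \/ insens c H) ->
  Ex s (fun g => F g * H g) f = Ex s F f * Ex s H f.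
Proof.
move=> FH; elim: s f => [|c s IH] f //=.
under eq_bigr do rewrite IH.
case: (FH c) => /(@insens_Ex s) ic.
  under eq_bigr do rewrite ic mulrCA.
  rewrite -mulr_sumr; congr (_ * _).
  by under [RHS]eq_bigr do rewrite ic; rewrite -mulr_suml mu_sum1 mul1r.
under eq_bigr do rewrite ic mulrA.
rewrite -mulr_suml; congr (_ * _).
by under [RHS]eq_bigr do rewrite ic; rewrite -mulr_suml mu_sum1 mul1r.
Qed.

Lemma Ex_freeze s c (G : A -> (T -> A) -> R) f :
  c \notin s -> Ex s (fun g => G (g c) g) f = Ex s (G (f c)) f.
Proof.
elim: s f => [|d s IH] f //=; rewrite inE negb_or => /andP[cd cs].
by apply: eq_bigr => a _; rewrite IH // /upd (negbTE cd).
Qed.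

Lemma expR_le_quad (x : R) : x <= 2^-1 -> expR x <= 1 + x + 2 * x ^+ 2.
Proof.
move=> x2; have := expR_ge1Dx (- x) => h.
have e0 := expR_gt0 x.
have : (1 - x) * expR x <= 1.
  by rewrite -[leRHS](expRxMexpNx_1 x) mulrC ler_wpM2l // ltW.
move=> h1.
have h2 : 1 <= (1 - x) * (1 + x + 2 * x ^+ 2).
  have -> : (1 - x) * (1 + x + 2 * x ^+ 2) = 1 + x ^+ 2 * (1 - 2 * x) by ring.
  by rewrite lerDl mulr_ge0 ?sqr_ge0 //; lra.
have x1 : 0 < 1 - x by lra.
by rewrite -(ler_pM2l x1) (le_trans h1).
Qed.

(** McDiarmid-type exponential moment bound: coordinates are averaged one at a time. Each increment
    [h a - hb] has mean zero and size at most [D c], so [expR_le_quad] bounds its exponential moment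
    by [1 + 2 * D c ^+ 2]. *)
Lemma Ex_expR_bounded_diff (D : T -> R) s F f :
  (forall c, 0 <= D c <= 2^-1) ->
  (forall g c a b, `|F (upd g c a) - F (upd g c b)| <= D c) ->
  Ex s (expR \o F) f <= expR (Ex s F f + 2 * \sum_(c <- s) D c ^+ 2).
Proof.
move=> D2 FD.
(* Averaging over further coordinates preserves the bounded differences. *)
have ExD_ t g c a b : `|Ex t F (upd g c a) - Ex t F (upd g c b)| <= D c.
  elim: t g => [|d t IH] g /=; first exact: FD.
  rewrite -sumrB; apply: (le_trans (ler_norm_sum _ _ _)).
  rewrite -[leRHS]mul1r -mu_sum1 mulr_suml; apply: ler_sum => e _.
  rewrite -mulrBr normrM ger0_norm // ler_wpM2l //.
  case: (eqVneq c d) => [->|cd]; last by rewrite !(upd_comm _ _ _ cd).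
  by rewrite !upd_same subrr normr0; case/andP: (D2 d).
elim: s f => [|c s IH] f /=; first by rewrite big_nil mulr0 addr0.
set h := fun a => Ex s F (upd f c a).
set hb := \sum_a mu a * h a.
have hD a : `|h a - hb| <= D c.
  have -> : h a - hb = \sum_b mu b * (h a - h b).
    by under eq_bigr do rewrite mulrBr; rewrite sumrB -mulr_suml mu_sum1 mul1r.
  apply: (le_trans (ler_norm_sum _ _ _)).
  rewrite -[leRHS]mul1r -mu_sum1 mulr_suml; apply: ler_sum => b _.
  by rewrite normrM ger0_norm // ler_wpM2l // ExD_.
rewrite big_cons.
apply: (@le_trans _ _ (\sum_a mu a * (expR (h a - hb) *
    expR (hb + 2 * \sum_(j <- s) D j ^+ 2)))).
  apply: ler_sum => a _; rewrite ler_wpM2l // (le_trans (IH _)) //.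
  by rewrite -expRD ler_expR -/(h a); lra.
under [leLHS]eq_bigr do rewrite mulrA.
rewrite -mulr_suml.
have -> : hb + 2 * (D c ^+ 2 + \sum_(j <- s) D j ^+ 2) =
  2 * D c ^+ 2 + (hb + 2 * \sum_(j <- s) D j ^+ 2) by ring.
rewrite [leRHS]expRD ler_wpM2r ?expR_ge0 //.
apply: le_trans (expR_ge1Dx _).
apply: (@le_trans _ _ (\sum_a mu a * (1 + (h a - hb) + 2 * D c ^+ 2))).
  apply: ler_sum => a _; rewrite ler_wpM2l //.
  have hDa := hD a; have /andP[D0 D12] := D2 c.
  apply: (le_trans (expR_le_quad _)).
    exact: le_trans (le_trans (ler_norm _) hDa) D12.
  rewrite lerD2l ler_wpM2l // -real_normK ?num_real //.
  by rewrite lerXn2r // nnegrE.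
under [leLHS]eq_bigr do rewrite !mulrDr mulr1 mulrN.
rewrite !big_split /= sumrN -/hb -!mulr_suml mu_sum1 !mul1r; lra.
Qed.

Lemma Ex_markov s F f (q : R) :
  Ex s (fun g => (q <= F g)%R%:R) f <= expR (- q) * Ex s (expR \o F) f.
Proof.
rewrite -ExZ; apply: Ex_le => g /=; rewrite -expRD.
case: (leP q (F g)) => [qF|_] /=; last exact: expR_ge0.
by rewrite (le_trans _ (expR_ge1Dx _)) //; lra.
Qed.

End IteratedExpectation.

(** * Avoiding locally dependent bad events *)

Section CountingLemma.
Context {R : realType} {T : choiceType} {A : finType} (mu : A -> R).
Context (mu_ge0 : forall a, 0 <= mu a) (mu_sum1 : \sum_a mu a = 1).
Context (s0 : seq T) (f0 : T -> A).
Context {I : eqType} (es : seq I) (Sev : I -> {fset T}).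
Context (bad : I -> (T -> A) -> bool) (P : I -> R) (eta : R).
Context (bad_insens : forall i c, c \notin Sev i -> insens c (bad i)).
Context (badP : forall i, i \in es -> Ex mu s0 (fun f => (bad i f)%:R) f0 <= P i).
Context (Sev_neq0 : forall i, i \in es -> Sev i != fset0).
Context (eta01 : 0 <= eta < 1).
Context (P_sum : forall c, \sum_(i <- es | c \in Sev i) P i * (1 - eta) ^- #|` Sev i| <= eta).

Let good (S : {fset T}) f := all (fun i => (Sev i `<=` S) ==> ~~ bad i f) es.
Let Z (S : {fset T}) := Ex mu s0 (fun f => (good S f)%:R) f0.

Let eta_gt0 : 0 < 1 - eta. Proof. by case/andP: eta01; lra. Qed.
Let eta_le1 : 1 - eta <= 1. Proof. by case/andP: eta01; lra. Qed.

Let Z_ge0 S : 0 <= Z S.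
Proof. exact: Ex_ge0. Qed.

Let good_insens S c : c \notin S -> insens c (good S).
Proof.
move=> cS f a; apply: eq_all => i; case: (boolP (Sev i `<=` S)) => //= /fsubsetP iS.
by rewrite bad_insens //; apply: contra cS; exact: iS.
Qed.

Let good_sub S S' f : S `<=` S' -> good S' f -> good S f.
Proof.
move=> SS' /allP h; apply/allP => i /h /implyP hi; apply/implyP => iS; apply: hi.
exact: fsubset_trans iS SS'.
Qed.

(** Points of [S'] are deleted one at a time, each at the cost of a factor [1 - eta]. The premise is
    the induction hypothesis of [Z_step], available only for sets of fewer than [N] points. *)
Let Z_setD N : (forall S c, (#|` S| < N)%N -> c \notin S -> (1 - eta) * Z S <= Z (c |` S)) ->
  forall S S', (#|` S| <= N)%N -> (1 - eta) ^+ #|` S'| * Z (S `\` S') <= Z S.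
Proof.
move=> IH S S' SN.
suff h : (1 - eta) ^+ #|` S `&` S'| * Z (S `\` S') <= Z S.
  apply: le_trans h; rewrite ler_wpM2r ?Z_ge0 //.
  apply: ler_wiXn2l => //; first exact: ltW eta_gt0.
  by rewrite fsubset_leq_card // fsubsetIr.
move: {2}(#|` S `&` S'|) (erefl (#|` S `&` S'|)) => k.
elim: k S SN => [|k IHk] S SN Ek.
  rewrite Ek expr0 mul1r; suff -> : S `\` S' = S by [].
  by apply/fsetDidPl; rewrite -fsetI_eq0 -cardfs_eq0 Ek.
have [c] : exists c, c \in S `&` S'.
  by apply/fset0Pn; rewrite -cardfs_eq0 Ek.
rewrite in_fsetI => /andP[cS cS'].
pose S1 := S `\ c.
have S1c : c \notin S1 by rewrite !inE eqxx.
have S1E : c |` S1 = S by rewrite fsetD1K.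
have S1card : (#|` S1| < #|` S|)%N by rewrite -S1E cardfsU1 S1c.
have S1D : S1 `\` S' = S `\` S'.
  apply/fsetP => x; rewrite !inE; case: (eqVneq x c) => [->|_] //=.
  by rewrite cS'.
have S1I : #|` S1 `&` S'| = k.
  have -> : S1 `&` S' = (S `&` S') `\ c by apply/fsetP => x; rewrite !inE andbA.
  by have := cardfsD1 c (S `&` S'); rewrite in_fsetI cS cS' Ek add1n => -[].
have := IHk S1 (leq_trans (ltnW S1card) SN) S1I.
rewrite S1I S1D Ek exprS -mulrA => h.
apply: (@le_trans _ _ ((1 - eta) * Z S1)); first by rewrite ler_wpM2l // ltW.
by rewrite -[in leRHS]S1E; apply: IH => //; exact: leq_trans S1card SN.
Qed.

(** A configuration good for [S] but not for [S] with [c] added is spoiled by a bad event whose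
    support contains [c]. That event is independent of goodness on [S] minus its support, whose
    probability [Z_setD] compares with [Z S]; [P_sum] bounds the total loss by [eta * Z S]. *)
Let Z_step S c : c \notin S -> (1 - eta) * Z S <= Z (c |` S).
Proof.
move: {2}(#|` S|).+1 (ltnSn #|` S|) => N; elim: N S c => [|N IH] S c //.
rewrite ltnS => SN cS.
have key : Z S - \sum_(i <- es | c \in Sev i)
    Ex mu s0 (fun f => (bad i f)%:R * (good (S `\` Sev i) f)%:R) f0 <= Z (c |` S).
  rewrite -Ex_sum // -ExB //; apply: Ex_le => // f.
  have sum_ge0 : 0 <= \sum_(i <- es | c \in Sev i)
      (bad i f)%:R * (good (S `\` Sev i) f)%:R :> R.
    by apply: sumr_ge0 => i _; rewrite mulr_ge0.
  case: (boolP (good S f)) => gS; last by rewrite /= sub0r (@le_trans _ _ 0) ?oppr_le0.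
  case: (boolP (good (c |` S) f)) => gcS /=; first by lra.
  have /allPn[i ies] := gcS; rewrite negb_imply negbK => /andP[icS bi].
  have ci : c \in Sev i.
    apply: contraT => ci; have /allP/(_ i ies) := gS; rewrite bi implybF => /negP[].
    apply/fsubsetP => x xi; have := fsubsetP icS x xi.
    by rewrite !inE => /orP[/eqP xc|//]; rewrite -xc xi in ci.
  have gD : good (S `\` Sev i) f by apply: good_sub gS; exact: fsubsetDl.
  rewrite (big_rem i) //= ci bi gD mulr1.
  have : 0 <= \sum_(y <- rem i es | c \in Sev y) (bad y f)%:R * (good (S `\` Sev y) f)%:R :> R.
    by apply: sumr_ge0 => j _; rewrite mulr_ge0.
  by move=> h; rewrite opprD addrA subrr sub0r oppr_le0.
apply: le_trans key.
rewrite mulrBl mul1r lerD2l lerN2.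
apply: (@le_trans _ _ ((\sum_(i <- es | c \in Sev i) P i * (1 - eta) ^- #|` Sev i|) * Z S));
  last by rewrite ler_wpM2r.
rewrite mulr_suml big_seq_cond [leRHS]big_seq_cond; apply: ler_sum => i /andP[ies ci].
rewrite Ex_indep //; last first.
  move=> d; case: (boolP (d \in Sev i)) => di; [right|left] => f a; congr (_%:R).
    by rewrite good_insens // !inE di.
  by rewrite bad_insens.
have P0 : 0 <= P i by apply: le_trans (badP ies); exact: Ex_ge0.
apply: (@le_trans _ _ (P i * Z (S `\` Sev i))); first by rewrite ler_wpM2r ?Z_ge0 // badP.
rewrite -mulrA ler_wpM2l // mulrC ler_pdivlMr ?exprn_gt0 // mulrC.
by apply: (Z_setD (N := N)).
Qed.

(* Rosenfeld's counting argument, replacing the asymmetric local lemma: adding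
   one variable costs at most a factor [1 - eta] in the probability that no bad
   event supported on the variables considered so far occurs. *)
Lemma avoid_bad_events :
  exists f, forall i, i \in es -> ~~ bad i f.
Proof.
have Z_gt0 S : 0 < Z S.
  move: {2}(#|` S|) (erefl (#|` S|)) => k; elim: k S => [|k IH] S Sk.
    rewrite (cardfs0_eq Sk) /Z (@eq_Ex _ _ _ _ _ _ (fun=> 1)) ?Ex_cst // => f.
    suff -> : good fset0 f by [].
    by apply/allP => i ies; rewrite fsubset0 (negbTE (Sev_neq0 ies)).
  have [c cS] : exists c, c \in S by apply/fset0Pn; rewrite -cardfs_eq0 Sk.
  have cS1 : c \notin S `\ c by rewrite !inE eqxx.
  have := Z_step cS1; rewrite fsetD1K //; apply: lt_le_trans.
  apply: mulr_gt0 => //; apply: IH; apply/eqP.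
  by rewrite -eqSS -Sk (cardfsD1 c S) cS.
(* Goodness on the union of all supports excludes every event of [es], so positivity of [Z S] yields
   a configuration. *)
pose S := \bigcup_(i <- es) Sev i.
apply: contrapT => /forallNP nof.
have : Z S = 0.
  rewrite /Z (@eq_Ex _ _ _ _ _ _ (fun=> 0)) ?Ex_cst // => f.
  case: (boolP (good S f)) => //= /allP gf; case: (nof f) => i ies.
  have /implyP := gf i ies; apply; exact: bigfcup_sup.
by move=> Z0; have := Z_gt0 S; rewrite Z0 ltxx.
Qed.
End CountingLemma.

(** * Cayley balls *)

Section CayleyMetric.
Context {G : groupType} (S : {fset G}) (genS : generates S).
Local Notation d := (cayley_dist S).
Local Notation ball := (cayley_ball S).
Local Notation b n := #|` cayley_ball S 1%g n|.

Lemma cayley_dist_walk (g h : G) : cayley_walk S g h (d g h).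
Proof.
have [m md wm] := (cayley_dist_leP g h (d g h) genS).1 (leqnn _).
have : (d g h <= m)%N by apply/cayley_dist_leP => //; exists m.
by move=> dm; have -> : d g h = m by apply/eqP; rewrite eqn_leq dm md.
Qed.

Lemma cayley_dist_le_walk (g h : G) n : cayley_walk S g h n -> (d g h <= n)%N.
Proof. by move=> w; apply/cayley_dist_leP => //; exists n. Qed.

Lemma cayley_distC (g h : G) : d g h = d h g.
Proof.
apply/eqP; rewrite eqn_leq.
by apply/andP; split; apply: cayley_dist_le_walk; apply: cayley_walk_sym;
  exact: cayley_dist_walk.
Qed.

Lemma cayley_dist_triangle (g h k : G) : (d g k <= d g h + d h k)%N.
Proof.
apply: cayley_dist_le_walk.
by apply: cayley_walk_cat; exact: cayley_dist_walk.
Qed.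

Lemma cayley_distxx (g : G) : d g g = 0%N.
Proof.
by apply/eqP; rewrite -leqn0; apply: cayley_dist_le_walk; exists [::].
Qed.

Lemma cayley_walk_mul (k g h : G) n :
  cayley_walk S g h n -> cayley_walk S (k * g)%g (k * h)%g n.
Proof.
move=> [p [pp lp sp]]; exists [seq (k * x)%g | x <- p]; split.
- rewrite path_map; apply: sub_path pp => x y /= /asboolP[s sS e].
  by apply/asboolP; exists s => //; case: e => ->; [left|right]; rewrite mulgA.
- by rewrite last_map lp.
- by rewrite size_map.
Qed.

Lemma cayley_dist_mul (k g h : G) : d (k * g)%g (k * h)%g = d g h.
Proof.
apply/eqP; rewrite eqn_leq; apply/andP; split; apply: cayley_dist_le_walk.
  by apply: cayley_walk_mul; exact: cayley_dist_walk.
rewrite -{1}(mulKg k g) -{1}(mulKg k h).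
by apply: cayley_walk_mul; exact: cayley_dist_walk.
Qed.

Lemma cayley_between (g h : G) k : (k <= d g h)%N ->
  exists2 z, (d g z <= k)%N & (d z h <= d g h - k)%N.
Proof.
have [p [pp lp sp]] := cayley_dist_walk g h; move=> kd.
move: pp lp; rewrite -(cat_take_drop k p) cat_path last_cat => /andP[pt pd] ld.
exists (last g (take k p)); apply: cayley_dist_le_walk.
  by exists (take k p); split=> //; rewrite size_takel // sp.
by exists (drop k p); split => //; rewrite size_drop sp.
Qed.

Lemma mem_cayley_ball (g h : G) n : (h \in ball g n) = (d g h <= n)%N.
Proof. exact: cayley_ballE. Qed.

Lemma card_cayley_ball (g : G) n : #|` ball g n| = b n.
Proof.
suff -> : ball g n = [fset (g * h)%g | h in ball 1%g n].
  by rewrite card_imfset //= => x y /mulgI.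
apply/fsetP => h; rewrite mem_cayley_ball; apply/idP/imfsetP => /= [gh|[x]].
  by exists (g^-1 * h)%g; rewrite ?mulVKg // mem_cayley_ball -(cayley_dist_mul g) mulg1 mulVKg.
by rewrite mem_cayley_ball -(cayley_dist_mul g) mulg1 => h1 ->.
Qed.

Lemma card_cayley_ball_gt0 n : (0 < b n)%N.
Proof. by rewrite cardfs_gt0; apply/fset0Pn; exists 1%g; rewrite mem_cayley_ball cayley_distxx. Qed.

(** A geodesic is cut at distance [m] from the identity; left invariance moves its second half back
    to the identity. *)
Lemma card_cayley_ballD m n : (b (m + n) <= b m * b n)%N.
Proof.
rewrite -(size_allpairs (fun x y => x * y)%g); apply: uniq_leq_size => // h.
rewrite mem_cayley_ball => h1; apply/allpairsP.
have [hm|/ltnW hm] := leqP (d 1%g h) m.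
  by exists (h, 1%g); rewrite !mem_cayley_ball cayley_distxx mulg1.
have [z z1 z2] := cayley_between hm.
exists (z, z^-1 * h)%g; rewrite !mem_cayley_ball mulVKg /=; split=> //.
by rewrite -(cayley_dist_mul z) mulg1 mulVKg (leq_trans z2) // leq_subLR.
Qed.

(** Some point lies beyond distance [n]; a geodesic to it supplies points at all distances from 0 to
    [n]. *)
Lemma ltn_card_cayley_ball n : infinite_set [set: G] -> (n < b n)%N.
Proof.
move=> infG.
have [h hn] : exists h, (n < d 1%g h)%N.
  apply: contrapT => /forallNP nh; apply: infG.
  apply: (sub_finite_set _ (finite_fset (ball 1%g n))) => x _ /=.
  by rewrite mem_cayley_ball leqNgt; apply/negP; exact: nh.
have Z k : exists z, (k <= n)%N -> d 1%g z = k.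
  have [kn|_] := leqP k n; last by exists 1%g.
  have kh : (k <= d 1%g h)%N by apply: leq_trans kn (ltnW hn).
  have [z z1 z2] := cayley_between kh; exists z => _.
  have := cayley_dist_triangle 1%g z h; lia.
have [z zP] := choice Z.
have -> : n.+1 = size [seq z k | k <- iota 0 n.+1] by rewrite size_map size_iota.
apply: uniq_leq_size.
  rewrite map_inj_in_uniq ?iota_uniq // => i j.
  rewrite !mem_iota /= !add0n !ltnS => ni nj e.
  by rewrite -(zP i ni) -(zP j nj) e.
move=> x /mapP[k]; rewrite mem_iota /= add0n ltnS => kn ->.
by rewrite mem_cayley_ball zP.
Qed.

(** If [p] is at distance at least [r] from [g], moving [r] steps from [p] towards [g] gives [z];
    otherwise [g] itself serves. *)
Lemma cayley_inner_ball (g p : G) r n : (r <= n)%N -> (d g p <= n)%N ->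
  exists2 z, (d p z <= r)%N & ball z r `<=` ball g n.
Proof.
move=> rn pn; have [rp|/ltnW pr] := leqP r (d p g).
  have [z pz zg] := cayley_between rp; exists z => //.
  apply/fsubsetP => x; rewrite !mem_cayley_ball => zx.
  have := cayley_dist_triangle g z x; have := cayley_distC g z.
  have := cayley_distC g p; lia.
exists g => //; apply/fsubsetP => x; rewrite !mem_cayley_ball => h.
exact: leq_trans h rn.
Qed.

(* Each point of a maximal 4r-separated subset owns a ball of radius r inside
   the big ball, whatever the size of the boundary of the latter. *)
Lemma cayley_net (g : G) r n : (r <= n)%N ->
  exists2 P : seq G, (forall v, v \in ball g n ->
      exists2 i, (i < size P)%N & (d v (nth 1%g P i) <= 4 * r)%N) &
    (size P * b r <= b n)%N.
Proof.
move=> rn.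
have greedy (s : seq G) : exists P : seq G, [/\ {subset P <= s},
    (forall v, v \in s -> has (fun p => d v p <= 4 * r)%N P) &
    pairwise (fun p q => 4 * r < d p q)%N P].
  elim: s => [|v s [P [Ps sP PP]]]; first by exists [::].
  case: (boolP (has (fun p => d v p <= 4 * r)%N P)) => vP.
    exists P; split => // [x /Ps xs|x]; first by rewrite inE xs orbT.
    by rewrite inE => /orP[/eqP ->|/sP].
  exists (v :: P); split => [x||].
  - by rewrite !inE => /orP[->//|/Ps ->]; rewrite orbT.
  - move=> x; rewrite inE => /orP[/eqP ->|/sP] /=; first by rewrite cayley_distxx.
    by move=> ->; rewrite orbT.
  - rewrite /= PP andbT; apply/allP => p pP; rewrite ltnNge; apply: contra vP => h.
    by apply/hasP; exists p.
have [P [Ps sP PP]] := greedy (ball g n); exists P.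
  by move=> v /sP h; exists (find (fun p => d v p <= 4 * r)%N P);
    [rewrite -has_find | exact: (nth_find 1%g h)].
have Z p : exists z, p \in ball g n -> (d p z <= r)%N /\ ball z r `<=` ball g n.
  case: (boolP (p \in ball g n)) => [|_]; last by exists 1%g.
  by rewrite mem_cayley_ball => /(cayley_inner_ball rn)[z]; exists z.
have [z zP] := choice Z.
(* Each [z p] lies within [r] of [p]; a point common to the balls of two net points would put these
   within [4 * r], so the balls are disjoint. *)
have uniqF : uniq (flatten [seq enum_fset (ball (z p) r) | p <- P]).
  elim: P Ps PP {sP} => [|p P IH] //= Ps /andP[pP PP].
  rewrite cat_uniq fset_uniq /= IH ?andbT //; last by move=> x xP; apply: Ps; rewrite inE xP orbT.
  apply/hasPn => x /flattenP[_ /mapP[q qP ->] xq] /=.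
  have [pz _] := zP p (Ps p (mem_head _ _)).
  have [qz _] : (d q (z q) <= r)%N /\ ball (z q) r `<=` ball g n.
    by apply: zP; apply: Ps; rewrite inE qP orbT.
  have {}xq : (d (z q) x <= r)%N by rewrite -mem_cayley_ball.
  apply/negP => xp; have {}xp : (d (z p) x <= r)%N by rewrite -mem_cayley_ball.
  have /allP/(_ q qP) := pP.
  have := cayley_dist_triangle p (z p) q.
  have := cayley_dist_triangle (z p) x q.
  have := cayley_dist_triangle x (z q) q.
  have := cayley_distC (z q) q; have := cayley_distC x (z q); lia.
have -> : (size P * b r)%N = size (flatten [seq enum_fset (ball (z p) r) | p <- P]).
  rewrite size_flatten /shape -map_comp.
  elim: P {uniqF Ps sP PP} => //= p P <-.
  by rewrite -(card_cayley_ball (z p)) mulSn.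
rewrite -(card_cayley_ball g); apply: uniq_leq_size => // x /flattenP[_ /mapP[p pP ->]].
by have [_ /fsubsetP] := zP p (Ps p pP); exact.
Qed.

End CayleyMetric.

(** * Growth *)

Lemma exists_root_gt1 (R : realType) (q : R) n : 1 < q -> (0 < n)%N ->
  exists2 r, 1 < r & r ^+ n = q.
Proof.
move=> q1 n0; have q0 : 0 < q by lra.
have rn : (q `^ n%:R^-1) ^+ n = q.
  by rewrite -powR_mulrn ?powR_ge0 // -powRrM mulVf ?powRr1 // ?pnatr_eq0 -?lt0n // ltW.
exists (q `^ n%:R^-1) => //; rewrite ltNge; apply/negP => r1.
by have := exprn_ile1 n (powR_ge0 _ _) r1; rewrite rn leNgt q1.
Qed.

(** Words over [S] lengthen by at most a constant factor [C] when rewritten over [S0]; the growth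
    bound over [S0] is then used with base the [C]-th root of [r]. *)
Lemma ball_subexp (R : realType) (G : groupType) (S : {fset G}) (r : R) :
  generates S -> subexponential_growth R G -> 1 < r ->
  exists N, forall n, (N <= n)%N -> #|` cayley_ball S 1%g n|%:R <= r ^+ n.
Proof.
move=> genS [S0 genS0 cvg1] r1.
pose C := (\max_(s <- S) cayley_dist S0 1%g s).+1.
have walkC n g h : cayley_walk S g h n -> (cayley_dist S0 g h <= C * n)%N.
  move=> [p [pp <- <-]] {n h}; elim: p g pp => [|a p IH] g /=.
    by rewrite cayley_distxx.
  move=> /andP[/asboolP[s sS e] /IH h].
  rewrite mulnS (leq_trans (cayley_dist_triangle genS0 g a _)) // leq_add //.
  have sC : (cayley_dist S0 1%g s <= C)%N.
    by apply: leq_trans (leqnSn _); exact: (leq_bigmax_seq s).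
  have mulC x : cayley_dist S0 x (x * s)%g = cayley_dist S0 1%g s.
    by rewrite -{1}[x]mulg1 cayley_dist_mul.
  by case: e => ->; rewrite ?mulC // cayley_distC ?mulC.
have [r' r'1 r'C] := exists_root_gt1 r1 (ltn0Sn _ : (0 < C)%N).
have [N _ NP] := cvgr_lt _ cvg1 _ r'1.
exists N.+1 => n Nn.
have sub : cayley_ball S 1%g n `<=` cayley_ball S0 1%g (C * n).
  apply/fsubsetP => x; rewrite !mem_cayley_ball // => xn.
  apply: leq_trans (walkC _ _ _ (cayley_dist_walk genS 1%g x)) _.
  by rewrite leq_mul2l xn orbT.
apply: (@le_trans _ _ (#|` cayley_ball S0 1%g (C * n)|%:R)).
  by rewrite ler_nat fsubset_leq_card.
have Cn0 : (0 < C * n)%N by rewrite muln_gt0 /=; lia.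
rewrite -r'C -exprM.
have h : (N <= C * n)%N by rewrite /C; nia.
have {}h := ltW (NP _ h).
have r'0 : 0 <= r' by lra.
set m := (C * n)%N in Cn0 *.
rewrite -/m in h; set B := #|` _|%:R in h *.
have -> : B = (B `^ m%:R^-1) ^+ m.
  rewrite -powR_mulrn ?powR_ge0 // -powRrM mulVf ?powRr1 ?ler0n //.
  by rewrite pnatr_eq0 -lt0n.
by apply: lerXn2r; rewrite ?nnegrE ?powR_ge0.
Qed.

(** The truncation error of a geometric variable gets multiplied by the number of centres in range.
    With [r ^+ L = q] and [q ^+ 2 = 1 + kappa], the ball has at most [q ^+ J.+1] points for large
    [J], against a decay of [q ^- (J * 2)]; Bernoulli's inequality makes the product small. *)
Lemma ball_truncation (R : realType) (G : groupType) (S : {fset G}) (kappa delta : R) L :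
  generates S -> subexponential_growth R G -> 0 < kappa -> 0 < delta -> (0 < L)%N ->
  exists J, #|` cayley_ball S 1%g (L * J.+1)|%:R * (1 + kappa) ^- J <= delta.
Proof.
move=> genS sg k0 d0 L0.
have [q q1 q2] : exists2 q : R, 1 < q & q ^+ 2 = 1 + kappa by apply: exists_root_gt1 => //; lra.
have [r r1 rL] := exists_root_gt1 q1 L0.
have [N NP] := ball_subexp genS sg r1.
pose J0 := Num.truncn (q / ((q - 1) * delta)).
pose J := (N + J0.+1)%N.
exists J.
have q0 : 0 < q by lra.
have qJ0 n : 0 < q ^+ n by exact: exprn_gt0.
have h1 : #|` cayley_ball S 1%g (L * J.+1)|%:R <= q ^+ J.+1.
  rewrite -rL -exprM; apply: NP; rewrite /J; nia.
rewrite -q2 -exprM [(2 * J)%N]mulnC.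
apply: (@le_trans _ _ (q ^+ J.+1 * q ^- (J * 2))).
  by rewrite ler_wpM2r // invr_ge0 ltW.
rewrite muln2 -addnn exprD exprS ler_pdivrMr ?mulr_gt0 // mulrA ler_pM2r //.
have bern : 1 + J%:R * (q - 1) <= q ^+ J.
  elim: (J) => [|j IH]; first by rewrite mul0r addr0.
  rewrite exprS -natr1; apply: (@le_trans _ _ (q * (1 + j%:R * (q - 1)))); last by rewrite ler_pM2l.
  have : 0 <= j%:R * (q - 1) ^+ 2 by rewrite mulr_ge0 ?sqr_ge0.
  by nra.
apply: (@le_trans _ _ (delta * (1 + J%:R * (q - 1)))); last by rewrite ler_pM2l.
have h2 : q / ((q - 1) * delta) <= J%:R.
  have [] := andP (truncn_itv (_ : 0 <= q / ((q - 1) * delta))).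
    by rewrite divr_ge0 ?mulr_ge0 //; lra.
  move=> _ /ltW h; apply: (le_trans h); rewrite ler_nat /J /J0; lia.
rewrite ler_pdivrMr in h2; last by rewrite mulr_gt0 //; lra.
nra.
Qed.

(** * Arcs of the circle *)

Definition frac {R : realType} (t : R) : R := t - (Num.floor t)%:~R.

(** The half-open arc from [a] to [a + l] on the circle of reals modulo 1; it is the whole circle
    once [l >= 1]. *)
Definition inarc {R : realType} (a l t : R) : bool := frac (t - a) < l.

Section Arcs.
Context {R : realType}.
Implicit Types (t a l y : R).

Lemma frac_ge0 t : 0 <= frac t.
Proof. by rewrite subr_ge0 floor_le. Qed.

Lemma frac_lt1 t : frac t < 1.
Proof. by rewrite ltrBlDr -[X in X + _]/(1%:~R) -intrD addrC floorD1_gt. Qed.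

Lemma fracDz t (z : int) : frac (t + z%:~R) = frac t.
Proof. by rewrite /frac floorDrz ?intr_int // intrKfloor intrD; ring. Qed.

Lemma frac_id t : 0 <= t < 1 -> frac t = t.
Proof.
move=> /andP[t0 t1]; rewrite /frac.
suff -> : Num.floor t = 0 by rewrite subr0.
by apply/eqP; rewrite eq_le floor_le0 t1 floor_ge0.
Qed.

Lemma frac_le t : 0 <= t -> frac t <= t.
Proof. by move=> t0; rewrite /frac lerBlDr lerDl ler0z floor_ge0. Qed.

(** Approximating a perturbation from below by at most [e] costs a widening of the arc by [e]. *)
Lemma inarc_widen a l e s t : 0 <= s <= e ->
  inarc a l t -> inarc (a - e) (l + e) (t - s).
Proof.
move=> /andP[s0 se]; rewrite /inarc => h.
have -> : t - s - (a - e) = frac (t - a) + (e - s) + (Num.floor (t - a))%:~R.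
  by rewrite /frac; ring.
rewrite fracDz.
have := frac_le (_ : 0 <= frac (t - a) + (e - s)).
have := frac_ge0 (t - a) => f0 h1.
by apply: (le_lt_trans (h1 _)); lra.
Qed.

Lemma sum_grid_lt m (x : R) : 0 <= x -> \sum_(i < m) (i%:R < x)%R%:R <= x + 1 :> R.
Proof.
move=> x0; have : \sum_(i < m) (i%:R < x)%R%:R <= Num.min (m%:R : R) (x + 1).
  elim: m => [|m IH]; first by rewrite big_ord0 le_min lexx /=; lra.
  rewrite big_ord_recr /=; move: IH; rewrite !le_min => /andP[h1 h2].
  by case: ltP => mx; rewrite -natr1 /=; apply/andP; split; lra.
by rewrite le_min => /andP[].
Qed.

(** Rotation by one grid step permutes the grid modulo 1, so the offset reduces to some [y0] below
    [m%:R^-1]. There the fractional part of the [i]-th point is at least [i%:R / m%:R], and it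
    remains to count integers below [m%:R * l]. *)
Lemma sum_grid_inarc m a l y : (0 < m)%N -> 0 <= l ->
  \sum_(i < m) (inarc a l (i.+1%:R / m%:R + y))%:R <= m%:R * l + 1.
Proof.
move=> m0 l0; have mR0 : 0 < m%:R :> R by rewrite ltr0n.
pose h (y : R) (i : nat) : R := (frac (i%:R / m%:R + y) < l)%R%:R.
have shift y' : \sum_(i < m) h y' i.+1 = \sum_(i < m) h y' i.
  have := big_ord_recl m (h y') (op := +%R) (idx := 0).
  rewrite big_ord_recr /= => e.
  have hm : h y' m = h y' 0%N.
    by rewrite /h mul0r add0r divff ?gt_eqF // addrC (fracDz _ 1).
  by rewrite hm addrC in e; apply: (addrI (h y' 0%N)); rewrite e.
have shiftk k y' : \sum_(i < m) h (k%:R / m%:R + y') i = \sum_(i < m) h y' i.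
  elim: k => [|k <-]; first by rewrite mul0r add0r.
  rewrite -[RHS]shift; apply: eq_bigr => i _; rewrite /h; congr ((_ < _)%R%:R).
  by congr frac; rewrite -!natr1; field; rewrite gt_eqF.
have -> : \sum_(i < m) (inarc a l (i.+1%:R / m%:R + y))%:R = \sum_(i < m) h (y - a) i.
  by rewrite -shift; apply: eq_bigr => i _; rewrite /h /inarc addrA.
have [k [y0 [y00 y01 ->]]] : exists k y0, [/\ 0 <= y0, y0 < m%:R^-1 &
   \sum_(i < m) h (y - a) i = \sum_(i < m) h (k%:R / m%:R + y0) i].
  pose y1 := frac (y - a); pose k := Num.truncn (m%:R * y1).
  have /truncn_itv/andP[k1 k2] : 0 <= m%:R * y1 by rewrite mulr_ge0 // frac_ge0.
  exists k, (y1 - k%:R / m%:R); split.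
  - by rewrite subr_ge0 ler_pdivrMr // mulrC.
  - by rewrite ltrBlDr -[X in X + _]mul1r -mulrDl ltr_pdivlMr // mulrC addrC natr1.
  - apply: eq_bigr => i _; rewrite /h; congr ((_ < _)%R%:R).
    rewrite -[RHS](fracDz _ (Num.floor (y - a))); congr frac.
    by rewrite /y1 /frac; ring.
rewrite shiftk; apply: le_trans (sum_grid_lt m (mulr_ge0 (ltW mR0) l0)).
apply: ler_sum => i _; rewrite /h frac_id.
  rewrite [in leRHS]mulrC -ltr_pdivrMr //.
  case: ltP => il; last by rewrite ler0n.
  by rewrite (le_lt_trans _ il) // lerDl.
have i0 : 0 <= i%:R / m%:R :> R by rewrite divr_ge0.
rewrite addr_ge0 //=.
have : i%:R / m%:R + y0 < i.+1%:R / m%:R.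
  by rewrite -natr1 mulrDl mul1r ltrD2l.
by move/lt_le_trans; apply; rewrite ler_pdivrMr // mul1r ler_nat.
Qed.
End Arcs.

(** * The random Lipschitz field *)

Section TruncatedGeometric.
Context {R : realType} (kappa : R) (J m : nat) (kappa_gt0 : 0 < kappa) (m_gt0 : (0 < m)%N).

Let r : R := (1 + kappa)^-1.
Let w (j : nat) : R := r ^+ j / \sum_(k < J.+1) r ^+ k.

(** Law of an independent pair: geometric of ratio [(1 + kappa)^-1] truncated at [J], and uniform on
    [m] points. *)
Definition geo_wt (c : 'I_J.+1 * 'I_m) : R := w c.1 / m%:R.
(** The shift to [c.2.+1] makes every value positive, so that the field is positive at each of its
    centres. *)
Definition geo_val (c : 'I_J.+1 * 'I_m) : R := c.1%:R + c.2.+1%:R / m%:R.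

Let mR0 : 0 < m%:R :> R. Proof. by rewrite ltr0n. Qed.
Let r0 : 0 < r. Proof. by rewrite invr_gt0 addr_gt0. Qed.
Let Z1 : 1 <= \sum_(k < J.+1) r ^+ k.
Proof.
rewrite big_ord_recl expr0 lerDl; apply: sumr_ge0 => k _.
by rewrite exprn_ge0 // ltW.
Qed.
Let w_ge0 j : 0 <= w j.
Proof. by apply: divr_ge0; [exact: exprn_ge0 (ltW r0) | exact: le_trans ler01 Z1]. Qed.

Lemma geo_wt_ge0 c : 0 <= geo_wt c.
Proof. by rewrite divr_ge0 // ltW. Qed.

Let sum_geo (F : nat -> nat -> R) :
  \sum_(c : 'I_J.+1 * 'I_m) geo_wt c * F c.1 c.2 =
  \sum_(j < J.+1) w j * (m%:R^-1 * \sum_(i < m) F j i).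
Proof.
rewrite -(pair_bigA _ (fun (j : 'I_J.+1) (i : 'I_m) => geo_wt (j, i) * F j i)) /=.
apply: eq_bigr => j _; rewrite mulrA mulr_sumr; apply: eq_bigr => i _ //.
Qed.

Lemma geo_wt_sum1 : \sum_c geo_wt c = 1.
Proof.
under eq_bigr do rewrite -[geo_wt _]mulr1.
rewrite (sum_geo (fun _ _ => 1)) sumr_const card_ord mulVf ?gt_eqF //.
under eq_bigr do rewrite mulr1.
by rewrite -mulr_suml divff // gt_eqF //; exact: lt_le_trans ltr01 Z1.
Qed.

Lemma geo_val_gt0 c : 0 < geo_val c.
Proof. by rewrite ltr_wpDl // divr_gt0. Qed.

Lemma geo_val_le c : geo_val c <= J.+1%:R.
Proof.
rewrite -natr1 lerD ?ler_nat //; first by rewrite -ltnS.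
by rewrite ler_pdivrMr // mul1r ler_nat.
Qed.

(* Memorylessness up to the factor [1 + kappa]: conditioned on exceeding a
   threshold, a truncated geometric variable plus an independent uniform grid
   point is nearly uniform modulo 1. *)
Lemma geo_inarc_le (U : R -> bool) (a l x : R) : 0 <= l ->
  (forall y z, y <= z -> U y -> U z) ->
  \sum_c geo_wt c * (U (geo_val c - x) && inarc a l (geo_val c - x))%:R <=
  (l + m%:R^-1 + kappa) * (\sum_c geo_wt c * (U (geo_val c - x))%:R) +
  (1 + kappa) ^- J.
Proof.
move=> l0 upU.
pose v j i : R := j%:R + i.+1%:R / m%:R - x.
rewrite (sum_geo (fun j i => (U (v j i) && inarc a l (v j i))%:R)).
rewrite (sum_geo (fun j i => (U (v j i))%:R)).
pose u j : R := (U (v j 0%N))%:R.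
have v_ge j i : v j 0%N <= v j i.
  by rewrite lerD2r lerD2l ler_pM2r ?invr_gt0 // ler_nat.
have v_le j i : (i < m)%N -> v j i <= v j.+1 0%N.
  move=> im; rewrite lerD2r -(natr1 j) -addrA lerD2l.
  apply: (@le_trans _ _ 1); first by rewrite ler_pdivrMr // mul1r ler_nat.
  by rewrite lerDl divr_ge0.
(* If [U] holds at the start of block [j], it holds throughout and the grid estimate applies.
   Otherwise the block counts only if [U] holds by the start of the next one, and [u j.+1 - u j]
   pays for it. *)
have u_le j : w j * (m%:R^-1 * \sum_(i < m) (U (v j i) && inarc a l (v j i))%:R)
    <= w j * ((l + m%:R^-1) * u j + (u j.+1 - u j)).
  rewrite ler_wpM2l //; rewrite /u.
  case: (boolP (U (v j 0%N))) => Uj.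
    rewrite (upU _ _ (le_trans (v_ge j m.-1) (v_le j m.-1 _)) Uj); last by rewrite prednK.
    rewrite subrr addr0 mulr1 mulrC ler_pdivrMr //.
    rewrite mulrDl mulVf ?gt_eqF // [l * _]mulrC.
    apply: le_trans (sum_grid_inarc a (j%:R - x) m_gt0 l0).
    apply: ler_sum => i _.
    have -> : i.+1%:R / m%:R + (j%:R - x) = v j i by rewrite /v; ring.
    by case: (U _) => //=.
  rewrite mulr0 add0r subr0 mulrC ler_pdivrMr //.
  apply: (@le_trans _ _ (\sum_(i < m) (U (v j.+1 0%N))%:R)).
    apply: ler_sum => i _; case: (boolP (U (v j i))) => //= Ui.
    by rewrite (upU _ _ (v_le j i (ltn_ord i)) Ui); case: inarc.
  by rewrite sumr_const card_ord mulr_natr.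
apply: (@le_trans _ _ (\sum_(j < J.+1) w j * ((l + m%:R^-1) * u j + (u j.+1 - u j)))).
  by apply: ler_sum => j _; exact: u_le.
under [leLHS]eq_bigr do rewrite mulrDr mulrCA.
rewrite big_split /= -mulr_sumr.
(* Summation by parts: consecutive weights differ by the factor [1 + kappa], so the jumps cost
   [kappa] times the main sum plus a boundary term, which becomes the truncation error. *)
have abel n : \sum_(j < n.+1) w j * (u j.+1 - u j) <=
    w n * u n.+1 + kappa * \sum_(j < n.+1) w j * u j.
  have u0 j : 0 <= u j by [].
  elim: n => [|n IH].
    rewrite !big_ord_recl !big_ord0 !addr0 /=.
    have h0 := mulr_ge0 (w_ge0 0%N) (u0 0%N).
    have h1 := mulr_ge0 (ltW kappa_gt0) h0.
    rewrite mulrBr; move: h0 h1; set x0 := w 0%N * _ => h0 h1; lra.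
  rewrite [leLHS]big_ord_recr [in leRHS]big_ord_recr /=.
  have wS : w n = (1 + kappa) * w n.+1.
    have rk : (1 + kappa) * r = 1 by rewrite divff // gt_eqF // addr_gt0.
    by rewrite /w exprS 2!mulrA rk mul1r.
  have h := mulr_ge0 (w_ge0 n.+1) (u0 n.+1).
  rewrite wS in IH; rewrite mulrBr [kappa * (_ + _)]mulrDr; move: IH h.
  rewrite mulrDl mul1r mulrDl; set y := w n.+1 * _ => IH h.
  set z := \sum_(j < _) _ * u j in IH *; rewrite -[kappa * w _ * _]mulrA -/y in IH.
  lra.
have u_sum : \sum_(j < J.+1) w j * u j <=
    \sum_(j < J.+1) w j * (m%:R^-1 * \sum_(i < m) (U (v j i))%:R).
  apply: ler_sum => j _; rewrite ler_wpM2l // mulrC ler_pdivlMr //.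
  have -> : u j * m%:R = \sum_(i < m) u j by rewrite sumr_const card_ord mulr_natr.
  apply: ler_sum => i _; rewrite /u.
  by case: (boolP (U (v j 0%N))) => //= Uj; rewrite (upU _ _ (v_ge j i) Uj).
have wJ : w J * u J.+1 <= (1 + kappa) ^- J.
  rewrite -exprVn -/r -[leRHS]mulr1; apply: ler_pM => //; last by rewrite /u; case: (U _).
  rewrite /w ler_pdivrMr; last exact: lt_le_trans ltr01 Z1.
  by rewrite ler_peMr // exprn_ge0 // ltW.
have k0 := kappa_gt0.
have l1 : 0 <= l + m%:R^-1 by rewrite addr_ge0.
set X := \sum_(j < _) _ * (_ * _) in u_sum *.
have := abel J; set Y := \sum_(j < _) w j * u j in u_sum *.
nra.
Qed.

End TruncatedGeometric.

(** * Maximum of independent variables *)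

Section MaxField.
Context {R : realType} {T : choiceType} {A : finType} (mu : A -> R).
Context (mu_ge0 : forall a, 0 <= mu a) (mu_sum1 : \sum_a mu a = 1).
Context (val : A -> R) (x : T -> R) (rel : pred T) (J : R -> bool) (kappa tau : R).

(* The floor 0 makes the value independent of the centers [c] where
   [val - x c] is never positive. *)
Definition max_field (s : seq T) (g : T -> A) : R :=
  foldr (fun c y => Num.max (val (g c) - x c) y) 0 s.

Context (single : forall c (U : R -> bool), (forall y z, y <= z -> U y -> U z) -> ~~ U 0 ->
  \sum_a mu a * (U (val a - x c) && J (val a - x c))%:R <=
  kappa * (\sum_a mu a * (U (val a - x c))%:R) + tau * (rel c)%:R).

(** Given the maximum [M] over the other centres, the case where [c] exceeds [M] is the estimate
    [single] for [U] cut above [M]; given the value at [c], the other case is the induction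
    hypothesis for [U] cut at that value. Quantifying over upward closed [U] keeps such conditioning
    within the statement. *)
Lemma Ex_max_field_le s f (U : R -> bool) : uniq s ->
  (forall y z, y <= z -> U y -> U z) -> ~~ U 0 ->
  Ex mu s (fun g => (U (max_field s g) && J (max_field s g))%:R) f <=
  kappa * Ex mu s (fun g => (U (max_field s g))%:R) f + tau * \sum_(c <- s) (rel c)%:R.
Proof.
elim: s f U => [|c s IH] f U /=.
  by move=> _ _ U0; rewrite (negbTE U0) big_nil !mulr0 addr0.
move=> /andP[cs us] upU U0.
have insM : insens c (max_field s).
  move=> g a; rewrite /max_field; elim: s cs {us IH} => //= d s IHs.
  rewrite inE negb_or => /andP[cd cs]; rewrite IHs // /upd.
  by rewrite eq_sym (negbTE cd).
pose X a := val a - x c.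
have expand (Phi : R -> R) : \sum_a mu a * Ex mu s (fun g => Phi (Num.max (val (g c) - x c) (max_field s g))) (upd f c a)
    = \sum_a mu a * Ex mu s (fun g => Phi (Num.max (X a) (max_field s g))) f.
  apply: eq_bigr => a _; congr (_ * _).
  rewrite (@Ex_freeze _ _ _ _ _ _ (fun b g => Phi (Num.max (X b) (max_field s g)))) //.
  rewrite {1}/upd eqxx; apply: insens_Ex => // g b.
  by rewrite insM.
rewrite (expand (fun z => (U z && J z)%:R)) (expand (fun z => (U z)%:R)).
pose M := max_field s.
(* Ties go to [U2], so the two events partition the event that [U] holds at the maximum. *)
pose U1 a g := U (X a) && (M g < X a).
pose U2 a z := U z && (X a <= z).
have step1 : \sum_a mu a * Ex mu s (fun g => (U1 a g && J (X a))%:R) f <=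
    kappa * (\sum_a mu a * Ex mu s (fun g => (U1 a g)%:R) f) + tau * (rel c)%:R.
  have swap (F : A -> (T -> A) -> R) : \sum_a mu a * Ex mu s (F a) f =
      Ex mu s (fun g => \sum_a mu a * F a g) f.
    by rewrite Ex_sum //; apply: eq_bigr => a _; rewrite ExZ.
  rewrite !swap -ExZ -[X in _ + X](Ex_cst mu_sum1 s _ f) -ExD; apply: Ex_le => // g.
  apply: (@single c (fun z => U z && (M g < z))); last by rewrite (negbTE U0).
  by move=> y z yz /andP[/(upU _ _ yz) -> /lt_le_trans]; exact.
have step2 : \sum_a mu a * Ex mu s (fun g => (U2 a (M g) && J (M g))%:R) f <=
    kappa * (\sum_a mu a * Ex mu s (fun g => (U2 a (M g))%:R) f) + tau * \sum_(c <- s) (rel c)%:R.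
  set B := tau * _; have BE : B = \sum_a mu a * B by rewrite -mulr_suml mu_sum1 mul1r.
  rewrite [X in _ + X]BE mulr_sumr -big_split /=.
  apply: ler_sum => a _; rewrite mulrCA -mulrDr ler_wpM2l //.
  apply: (IH f (U2 a)) => //; last by rewrite /U2 (negbTE U0).
  by move=> y z yz /andP[/(upU _ _ yz) Uz /le_trans h]; rewrite /U2 Uz h.
rewrite big_cons.
have splitE (Phi : R -> bool) a g :
    (U (Num.max (X a) (M g)) && Phi (Num.max (X a) (M g)))%:R =
    (U1 a g && Phi (X a))%:R + (U2 a (M g) && Phi (M g))%:R :> R.
  rewrite /U1 /U2; case: ltP => h; rewrite /= ?andbF ?andbT ?addr0 ?add0r //.
have -> : \sum_a mu a * Ex mu s (fun g => (U (Num.max (X a) (M g)) && J (Num.max (X a) (M g)))%:R) f =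
  \sum_a mu a * Ex mu s (fun g => (U1 a g && J (X a))%:R) f +
  \sum_a mu a * Ex mu s (fun g => (U2 a (M g) && J (M g))%:R) f.
  rewrite -big_split /=; apply: eq_bigr => a _; rewrite -mulrDr -ExD; congr (_ * _).
  by apply: eq_Ex => g; exact: splitE.
have -> : \sum_a mu a * Ex mu s (fun g => (U (Num.max (X a) (M g)))%:R) f =
  \sum_a mu a * Ex mu s (fun g => (U1 a g)%:R) f +
  \sum_a mu a * Ex mu s (fun g => (U2 a (M g))%:R) f.
  rewrite -big_split /=; apply: eq_bigr => a _; rewrite -mulrDr -ExD; congr (_ * _).
  by apply: eq_Ex => g; have := splitE (fun=> true) a g; rewrite !andbT.
lra.
Qed.

End MaxField.

Section MaxFieldRegularity.
Context {R : realType} {T : choiceType} {A : finType} (val : A -> R).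

Lemma max_field_ge0 x s (g : T -> A) : 0 <= max_field val x s g.
Proof. by elim: s => //= c s IH; rewrite le_max IH orbT. Qed.

Lemma max_field_gt0 x s (g : T -> A) c :
  c \in s -> x c < val (g c) -> 0 < max_field val x s g.
Proof.
elim: s => //= b s IH; rewrite inE lt_max => /orP[/eqP -> h|/IH h /h ->].
  by rewrite subr_gt0 h.
by rewrite orbT.
Qed.

Lemma max_field_le_add x x' e s (g : T -> A) : 0 <= e ->
  (forall c, x' c <= x c + e) -> max_field val x s g <= max_field val x' s g + e.
Proof.
move=> e0 xx'; elim: s => [|c s IH] /=; first by rewrite add0r.
rewrite ge_max; apply/andP; split.
  apply: (@le_trans _ _ (val (g c) - x' c + e)); first by have := xx' c; lra.
  by rewrite lerD2r le_max lexx.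
by apply: (le_trans IH); rewrite lerD2r le_max lexx orbT.
Qed.

Lemma max_field_insens x s c :
  (forall a, val a <= x c) -> insens c (fun g : T -> A => max_field val x s g).
Proof.
move=> vx g a; elim: s => //= b s ->; rewrite /upd; case: eqP => // ->.
by rewrite !max_r // (le_trans _ (max_field_ge0 _ _ _)) // subr_le0.
Qed.

End MaxFieldRegularity.

(** * Finite nets for Lipschitz perturbations *)

Section LipschitzNet.
Context {R : realType} {G : groupType} (S : {fset G}) (genS : generates S).
Local Notation d := (cayley_dist S).
Local Notation ball := (cayley_ball S).
Local Notation b n := #|` cayley_ball S 1%g n|.

Definition cayley_lip (k : R) (f : G -> R) : Prop :=
  forall u v, f u - f v <= k * (d u v)%:R.

Lemma cayley_lipD k k' f f' : cayley_lip k f -> cayley_lip k' f' ->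
  cayley_lip (k + k') (fun v => f v + f' v).
Proof. by move=> hf hf' u v; have := hf u v; have := hf' u v; lra. Qed.

Lemma cayley_lip_le k k' f : k <= k' -> cayley_lip k f -> cayley_lip k' f.
Proof. by move=> kk hf u v; apply: (le_trans (hf u v)); rewrite ler_wpM2r. Qed.

Lemma cayley_lip0 k : 0 <= k -> cayley_lip k (fun=> 0).
Proof. by move=> k0 u v; rewrite subrr mulr_ge0. Qed.

(** The code [K] records the fractional part of [sigma], to precision [q%:R^-1], at each point of a
    [4 * r]-dense net. Off the net the Lipschitz bound adds an error of [4 * r%:R / L%:R] on either
    side. The bound on the number [k] of net points keeps the codes few. *)
Lemma cayley_lip_net (g : G) (r n q L : nat) (e := q%:R^-1 + 8 * r%:R / L%:R : R) :
  (r <= n)%N -> (0 < q)%N ->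
  exists k (sigma' : {ffun 'I_k -> 'I_q} -> G -> R), (k * b r <= b n)%N /\
    forall sigma, cayley_lip L%:R^-1 sigma -> exists K, forall v, v \in ball g n ->
      forall a l t, inarc a l (t + sigma v) -> inarc (a - e) (l + e) (t + sigma' K v).
Proof.
move=> rn q0; have [P coverP cardP] := cayley_net genS g rn.
have qR0 : 0 < q%:R :> R by rewrite ltr0n.
have idx v : exists i, v \in ball g n ->
    (i < size P)%N /\ (d v (nth 1%g P i) <= 4 * r)%N.
  case: (boolP (v \in ball g n)) => [/coverP[i iP di]|_]; last by exists 0%N.
  by exists i.
have [ix ixP] := choice idx.
(* Subtracting [4 * r%:R / L%:R] places [sigma'] below [sigma] modulo 1, as [inarc_widen] requires;
   the default 0 is never taken on the ball. *)
pose sigma' (K : {ffun 'I_(size P) -> 'I_q}) v : R :=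
  if insub (ix v) is Some i then (K i)%:R / q%:R - 4 * r%:R / L%:R else 0.
exists (size P), sigma'; split=> // sigma lip.
have Kt (i : 'I_(size P)) : (Num.truncn (q%:R * frac (sigma (nth 1%g P i))) < q)%N.
  rewrite truncn_lt_nat; last by rewrite mulr_ge0 // frac_ge0.
  by rewrite -[ltRHS]mulr1 ltr_pM2l // frac_lt1.
exists [ffun i => Ordinal (Kt i)] => v vB a l t h.
have [iP di] := ixP v vB.
rewrite /sigma' insubT /= ffunE /=.
set p := nth 1%g P (ix v) in di *.
have /truncn_itv/andP[] : 0 <= q%:R * frac (sigma p) by rewrite mulr_ge0 // frac_ge0.
set k := Num.truncn _ => k1 k2.
have dR : (d v p)%:R <= 4 * r%:R :> R by rewrite -natrM ler_nat.
have lv := lip v p; have lp := lip p v; rewrite (cayley_distC genS p v) in lp.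
have L0 : 0 <= L%:R^-1 :> R by rewrite invr_ge0.
have lvd : L%:R^-1 * (d v p)%:R <= 4 * r%:R / L%:R :> R by rewrite mulrC ler_wpM2r.
have kq : k%:R / q%:R <= frac (sigma p) by rewrite ler_pdivrMr // mulrC.
have kq1 : frac (sigma p) < k%:R / q%:R + q%:R^-1.
  by rewrite -[X in _ + X]mul1r -mulrDl ltr_pdivlMr // mulrC natr1.
pose s := sigma v - (k%:R / q%:R - 4 * r%:R / L%:R) - (Num.floor (sigma p))%:~R.
have sE : 0 <= s <= e.
  rewrite /s /e; move: kq kq1; rewrite /frac; set z := (_ %:~R) => kq kq1.
  have -> : 8 * r%:R / L%:R = 2 * (4 * r%:R / L%:R) :> R by ring.
  by move: lvd; set y := 4 * _ / _; set x := L%:R^-1 * _ in lv lp *; move=> *; lra.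
have := inarc_widen sE h; rewrite /inarc.
have -> : t + sigma v - s - (a - e) =
  t + (k%:R / q%:R - 4 * r%:R / L%:R) - (a - e) + (Num.floor (sigma p))%:~R.
  by rewrite /s; ring.
by rewrite fracDz.
Qed.

End LipschitzNet.

Lemma sumr_bool (R : pzSemiRingType) (T : Type) (s : seq T) (P : pred T) :
  \sum_(c <- s) (P c)%:R = (count P s)%:R :> R.
Proof. by elim: s => [|c s IH]; rewrite ?big_nil // big_cons IH -natrD. Qed.

Lemma count_leq_card (T : choiceType) (s : seq T) (P : pred T) (B : {fset T}) :
  uniq s -> (forall c, P c -> c \in B) -> (count P s <= #|` B|)%N.
Proof.
move=> us PB; rewrite -size_filter; apply: uniq_leq_size; first exact: filter_uniq.
by move=> c; rewrite mem_filter => /andP[/PB].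
Qed.

(** * Mean and tail bounds for the local random field *)

Section RandomField.
Context {R : realType} {G : groupType} (S : {fset G}) (genS : generates S).
Context (kappa : R) (J m L : nat) (kappa_gt0 : 0 < kappa) (m_gt0 : (0 < m)%N) (L_gt0 : (0 < L)%N).
Local Notation d := (cayley_dist S).
Local Notation ball := (cayley_ball S).
Local Notation b n := #|` cayley_ball S 1%g n|.
Local Notation rad := (L * J.+1)%N.
Local Notation mu := (@geo_wt R kappa J m).

Context (s0 : seq G) (s0_uniq : uniq s0).

Definition random_field (th : G -> 'I_J.+1 * 'I_m) (v : G) : R :=
  max_field (@geo_val R J m) (fun c => (d c v)%:R / L%:R) s0 th.

Lemma random_field_lip th : cayley_lip S L%:R^-1 (random_field th).
Proof.
move=> u v; rewrite lerBlDl; apply: max_field_le_add.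
  by rewrite mulr_ge0 // invr_ge0.
move=> c; rewrite [L%:R^-1 * _]mulrC -mulrDl ler_wpM2r ?invr_ge0 // -natrD ler_nat.
by rewrite (leq_trans (cayley_dist_triangle genS c u v)).
Qed.

(** Values are at most [J.+1], so beyond distance [rad] the contribution of [c] is nonpositive and
    absorbed by the floor 0. *)
Lemma random_field_insens c v : (rad < d c v)%N -> insens c (fun th => random_field th v).
Proof.
move=> cv; apply: max_field_insens => a.
rewrite (le_trans (geo_val_le m_gt0 a)) // ler_pdivlMr ?ltr0n // -natrM ler_nat mulnC.
exact: ltnW.
Qed.

(** Since [v] is itself a centre, the field is always positive at [v]. [Ex_max_field_le], with
    positivity as [U], charges the truncation error once for each centre within [rad]. *)
Lemma random_field_mean v a l w f : v \in s0 -> 0 <= l ->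
  Ex mu s0 (fun th => (inarc a l (w + random_field th v))%:R) f <=
  l + (m%:R^-1 + kappa + (1 + kappa) ^- J * (b rad)%:R).
Proof.
move=> vs l0.
have mu_ge0 c : 0 <= mu c by exact: geo_wt_ge0.
have mu_sum1 : \sum_c mu c = 1 by exact: geo_wt_sum1.
pose U (y : R) := 0 < y.
have inE y : inarc a l (w + y) = inarc (a - w) l y by rewrite /inarc; congr (frac _ < _); ring.
have phi_gt0 th : 0 < random_field th v.
  by apply: (max_field_gt0 vs); rewrite cayley_distxx // mul0r; exact: geo_val_gt0.
apply: (@le_trans _ _ (Ex mu s0 (fun th => (U (random_field th v) && inarc (a - w) l (random_field th v))%:R) f)).
  by apply: Ex_le => // th; rewrite /U phi_gt0 inE.
pose rel c := (d c v <= rad)%N.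
have tau0 : 0 <= (1 + kappa) ^- J by rewrite invr_ge0 exprn_ge0 // addr_ge0 // ltW.
have single c (V : R -> bool) : (forall y z, y <= z -> V y -> V z) -> ~~ V 0 ->
   \sum_a0 mu a0 * (V (geo_val a0 - (d c v)%:R / L%:R) && inarc (a - w) l (geo_val a0 - (d c v)%:R / L%:R))%:R <=
   (l + m%:R^-1 + kappa) * (\sum_a0 mu a0 * (V (geo_val a0 - (d c v)%:R / L%:R))%:R) + (1 + kappa) ^- J * (rel c)%:R.
  move=> upV V0; case: (boolP (rel c)) => rc; first by rewrite mulr1; exact: geo_inarc_le.
  have VF (a0 : 'I_J.+1 * 'I_m) : V (geo_val a0 - (d c v)%:R / L%:R) = false.
    apply: contraNF V0; apply: upV; rewrite subr_le0.
    rewrite (le_trans (geo_val_le m_gt0 a0)) // ler_pdivlMr ?ltr0n // -natrM ler_nat mulnC.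
    by apply: ltnW; rewrite ltnNge.
  by rewrite !big1 ?mulr0 ?addr0 // => a0 _; rewrite VF mulr0.
have upU y z : y <= z -> U y -> U z by move=> yz y0; exact: lt_le_trans y0 yz.
have U0 : ~~ U 0 by rewrite /U ltxx.
apply: (le_trans (Ex_max_field_le mu_ge0 mu_sum1 single f s0_uniq upU U0)).
have Ex1 : Ex mu s0 (fun th => (U (random_field th v))%:R) f <= 1.
  by rewrite -[leRHS](Ex_cst mu_sum1 s0 1 f); apply: Ex_le => // th; case: (U _).
have relE : \sum_(c <- s0) (rel c)%:R <= (b rad)%:R :> R.
  rewrite sumr_bool ler_nat -(card_cayley_ball genS v); apply: count_leq_card => // c.
  by rewrite mem_cayley_ball // cayley_distC.
have l1 : 0 <= l + m%:R^-1 + kappa.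
  by apply: addr_ge0 (ltW kappa_gt0); rewrite addr_ge0.
have h1 := ler_wpM2l l1 Ex1; have h2 := ler_wpM2l tau0 relE.
by rewrite mulr1 in h1; apply: (le_trans (lerD h1 h2)); rewrite !addrA.
Qed.

(** Chernoff bound by bounded differences: one centre changes the count by at most [b rad], and only
    centres in the ball of radius [n + rad] change it at all. *)
Lemma random_field_tail (B : {fset G}) g n a l w t q f :
  B = ball g n -> {subset B <= s0} -> 0 <= l -> 0 < t -> t * (b rad)%:R <= 2^-1 ->
  Ex mu s0 (fun th => (q <= \sum_(v <- B) (inarc a l (w v + random_field th v))%:R)%R%:R) f <=
  expR (- (t * q) + t * (#|` B|%:R * (l + (m%:R^-1 + kappa + (1 + kappa) ^- J * (b rad)%:R)))
        + 2 * (t ^+ 2 * (b rad)%:R ^+ 2 * (b (n + rad))%:R)).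
Proof.
move=> BE Bs0 l0 t_gt0 tD; have t0 := ltW t_gt0.
have mu_ge0 c : 0 <= mu c by exact: geo_wt_ge0.
have mu_sum1 : \sum_c mu c = 1 by exact: geo_wt_sum1.
pose cnt th : R := \sum_(v <- B) (inarc a l (w v + random_field th v))%:R.
pose F th := t * cnt th.
pose D c : R := t * (b rad)%:R * (c \in ball g (n + rad))%:R.
have tb0 : 0 <= t * (b rad)%:R by rewrite mulr_ge0.
have D2 c : 0 <= D c <= 2^-1.
  rewrite /D; case: (c \in _); rewrite ?mulr1 ?mulr0; first by rewrite tb0.
  by rewrite lexx invr_ge0 ler0n.
have FD th c x y : `|F (upd th c x) - F (upd th c y)| <= D c.
  have near v : v \in B -> ~~ (d c v <= rad)%N ->
      random_field (upd th c x) v = random_field (upd th c y) v.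
    by rewrite -ltnNge => _ /random_field_insens h; rewrite !h.
  rewrite /F -mulrBr normrM ger0_norm // /D -mulrA ler_wpM2l // /cnt -sumrB.
  apply: (le_trans (ler_norm_sum _ _ _)).
  apply: (@le_trans _ _ (\sum_(v <- B) (d c v <= rad)%N%:R)).
    rewrite big_seq [leRHS]big_seq; apply: ler_sum => v vB.
    case: (boolP (d c v <= rad)%N) => cv; last by rewrite (near v vB cv) subrr normr0.
    by case: inarc; case: inarc; rewrite /= ?subrr ?normr0 ?subr0 ?sub0r ?normrN ?normr1.
  rewrite sumr_bool; case: (boolP (c \in _)) => cB.
    rewrite mulr1 ler_nat -(card_cayley_ball genS c); apply: count_leq_card => // v.
    by rewrite mem_cayley_ball.
  rewrite mulr0 (_ : count _ _ = 0%N) //; apply/eqP; rewrite -leqn0 leqNgt -has_count.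
  apply: contra cB => /hasP[v vB cv]; rewrite mem_cayley_ball //.
  apply: leq_trans (cayley_dist_triangle genS g v c) _; apply: leq_add.
    by rewrite -mem_cayley_ball // -BE.
  by rewrite cayley_distC.
rewrite (@eq_Ex _ _ _ _ _ _ (fun th => (t * q <= F th)%R%:R)); last by move=> th; rewrite /F ler_pM2l.
apply: (le_trans (Ex_markov mu_ge0 _ _ _ _)).
apply: (le_trans (ler_wpM2l (expR_ge0 _) (Ex_expR_bounded_diff mu_ge0 mu_sum1 _ _ D2 FD))).
rewrite -expRD ler_expR -addrA lerD2l; apply: lerD.
  rewrite /F ExZ // ler_wpM2l // /cnt Ex_sum //.
  have -> : #|` B|%:R * (l + (m%:R^-1 + kappa + (1 + kappa) ^- J * (b rad)%:R)) =
     \sum_(v <- B) (l + (m%:R^-1 + kappa + (1 + kappa) ^- J * (b rad)%:R)).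
    by rewrite big_const_seq count_predT iter_addr addr0 mulr_natl.
  rewrite big_seq [leRHS]big_seq; apply: ler_sum => v vB.
  by apply: random_field_mean => //; exact: Bs0.
rewrite ler_wpM2l //.
have -> : \sum_(c <- s0) D c ^+ 2 = (t * (b rad)%:R) ^+ 2 * \sum_(c <- s0) (c \in ball g (n + rad))%:R.
  rewrite mulr_sumr; apply: eq_bigr => c _; rewrite /D exprMn; congr (_ * _).
  by case: (c \in _); rewrite ?expr1n ?expr0n.
rewrite exprMn ler_wpM2l ?mulr_ge0 ?sqr_ge0 // sumr_bool ler_nat.
by rewrite -(card_cayley_ball genS g); exact: count_leq_card.
Qed.

End RandomField.

Lemma exists_invn_le (R : realType) (x : R) : 0 < x -> exists2 n, (0 < n)%N & n%:R^-1 <= x.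
Proof.
move=> x0; exists (Num.truncn x^-1).+1 => //.
by rewrite -[leRHS]invrK lef_pV2 ?posrE ?invr_gt0 // ltW // truncnS_gt.
Qed.

(** The bound [expR y >= (y / 3) ^+ 3] turns exponential decay into [X%:R ^- 2], and [X > n]
    compares this with a telescoping difference, ready for summation over radii. *)
Lemma expR_decay (R : realType) (c : R) (X n : nat) : 0 < c -> (0 < n < X)%N ->
  X%:R * expR (- (c * X%:R / 2)) <= (6 / c) ^+ 3 * (n%:R^-1 - n.+1%:R^-1).
Proof.
move=> c0 /andP[n0 nX].
have X0 : 0 < X%:R :> R by rewrite ltr0n; lia.
have nR : 0 < n%:R :> R by rewrite ltr0n.
pose y : R := c * X%:R / 2.
have y0 : 0 < y by rewrite /y !mulr_gt0 // invr_gt0.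
have ey : y ^+ 3 / 27 <= expR y.
  have -> : expR y = expR (y / 3) ^+ 3.
    by rewrite -expRM_natl; congr expR; field.
  have -> : y ^+ 3 / 27 = (y / 3) ^+ 3 by field.
  rewrite lerXn2r ?nnegrE ?expR_ge0 //; first by rewrite divr_ge0 // ltW.
  by apply: le_trans (expR_ge1Dx _); lra.
rewrite -/y expRN ler_pdivrMr ?expR_gt0 //.
have -> : n%:R^-1 - n.+1%:R^-1 = (n%:R * n.+1%:R)^-1 :> R.
  by rewrite -natr1; field; rewrite gt_eqF // gt_eqF //; lra.
apply: (@le_trans _ _ ((6 / c) ^+ 3 * (n%:R * n.+1%:R)^-1 * (y ^+ 3 / 27))); last first.
  apply: ler_wpM2l => //; apply: mulr_ge0; last by rewrite invr_ge0 mulr_ge0.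
  by rewrite exprn_ge0 // divr_ge0 // ltW.
have -> : (6 / c) ^+ 3 * (n%:R * n.+1%:R)^-1 * (y ^+ 3 / 27) =
   X%:R * (X%:R ^+ 2 / (n%:R * n.+1%:R)).
  by rewrite /y; field; rewrite addrC natr1 !pnatr_eq0 (gt_eqF c0) -!lt0n n0.
rewrite ler_peMr ?(ltW X0) // ler_pdivlMr ?mulr_gt0 ?ltr0n // mul1r expr2.
by rewrite -!natrM ler_nat leq_mul // ltnW.
Qed.

(** * Equidistribution *)

(** [L'] and [n0] are chosen before [W], [N], the base [u] and the arcs, which permits iteration
    over scales and passage to infinite windows by compactness. *)
Lemma equidistribution_step (R : realType) (G : groupType) (S : {fset G}) (eps : R) (L : nat) :
  generates S -> infinite_set [set: G] -> subexponential_growth R G ->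
  0 < eps <= 1 -> (0 < L)%N ->
  exists L' n0, (0 < L')%N /\
    forall (W : seq G) N (u : G -> R) (arc : bool -> R * R), (forall c, 0 <= (arc c).2) ->
    exists2 phi, cayley_lip S L%:R^-1 phi &
    forall g n, g \in W -> (n0 <= n < N)%N ->
    forall sigma, cayley_lip S L'%:R^-1 sigma -> forall c,
      \sum_(v <- cayley_ball S g n) (inarc (arc c).1 (arc c).2 (u v + phi v + sigma v))%:R
      <= ((arc c).2 + eps) * #|` cayley_ball S g n|%:R.
Proof.
move=> genS infG sg /andP[e0 e1] L0.
pose ball := cayley_ball S; pose b n := #|` cayley_ball S 1%g n|.
have cardb g n : #|` ball g n| = b n by exact: card_cayley_ball.
have b_gt n : (n < b n)%N by exact: ltn_card_cayley_ball.
(* [kappa], the grid, the truncation and the net each contribute at most [eps / 16], so the mean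
   exceeds the arc length by at most [eps / 4]. *)
pose kappa := eps / 16.
have kappa0 : 0 < kappa by rewrite divr_gt0.
have [m m0 mP] := exists_invn_le kappa0.
have [J JP] := ball_truncation genS sg kappa0 kappa0 L0.
pose rad := (L * J.+1)%N.
pose D : R := (b rad)%:R.
have D1 : 1 <= D by rewrite ler1n; exact: leq_ltn_trans (leq0n _) (b_gt rad).
have D0 : 0 < D by exact: lt_le_trans D1.
have [q q0 qP] : exists2 q, (0 < q)%N & q%:R^-1 <= eps / 32 by apply: exists_invn_le; exact: divr_gt0.
(* The large deviation rate per point: with [t = eps / (8 * D ^+ 3)], the mean and
   bounded-difference terms use up half of the margin [eps], leaving [c0 = t * eps / 2]. *)
pose c0 : R := eps ^+ 2 / (16 * D ^+ 3).
have c00 : 0 < c0 by rewrite divr_gt0 ?mulr_gt0 ?exprn_gt0.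
(* Large enough that the [q ^+ k] codes number at most [expR (c0 * X / 4)] on a ball of [X]
   points. *)
pose r := (Num.truncn (4 * q%:R / c0)).+1.
have rP : 4 * q%:R / c0 <= (b r)%:R.
  apply: (@le_trans _ _ r%:R); last by rewrite ler_nat ltnW.
  by rewrite ltW // truncnS_gt.
have [L' L'0 L'P] : exists2 L', (0 < L')%N & L'%:R^-1 <= eps / 32 / (8 * r%:R).
  by apply: exists_invn_le; rewrite !divr_gt0 // mulr_gt0.
(* A bad event on [X] points depends on at most [X * D] centres, so the inverse power of [1 - eta]
   costs at most [expR (c0 * X / 4)]. *)
pose eta := 1 - expR (- (c0 / (4 * D))).
have etaE : 1 - eta = expR (- (c0 / (4 * D))) by rewrite /eta; ring.
have eta0 : 0 < eta by rewrite subr_gt0 -expR0 ltr_expR oppr_lt0 divr_gt0 // mulr_gt0.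
have eta1 : eta < 1 by rewrite /eta ltrBlDr ltrDl expR_gt0.
(* [K / n0%:R] will bound the weight of all bad events through one centre, summed over radii from
   [n0] on. *)
pose K := 2 * D * (6 / c0) ^+ 3.
have K0 : 0 < K by apply: mulr_gt0; [exact: mulr_gt0 | apply: exprn_gt0; exact: divr_gt0].
pose n0 := maxn r (Num.truncn (K / eta)).+1.
have rn0 : (r <= n0)%N by rewrite leq_maxl.
have n00 : (0 < n0)%N by exact: leq_trans rn0.
have Kn0 : K / n0%:R <= eta.
  rewrite ler_pdivrMr ?ltr0n // mulrC -ler_pdivrMr //.
  apply: (@le_trans _ _ (Num.truncn (K / eta)).+1%:R); first by rewrite ltW // truncnS_gt.
  by rewrite ler_nat leq_maxr.
exists L', n0; split=> // W N u arc arc0.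
pose s0 := undup (flatten [seq (ball g N : seq G) | g <- W]).
have s0_uniq : uniq s0 by exact: undup_uniq.
pose es := [seq (g, n) | n <- index_iota n0 N, g <- undup W].
pose A := ('I_J.+1 * 'I_m)%type.
pose mu := @geo_wt R kappa J m.
have mu_ge0 (c : A) : 0 <= mu c by exact: (geo_wt_ge0 kappa0).
have mu_sum1 : \sum_(c : A) mu c = 1 by exact: (geo_wt_sum1 J kappa0 m0).
pose th0 : G -> A := fun=> (ord0, Ordinal m0).
pose phi := random_field (R := R) S (J := J) (m := m) L s0.
pose Sev (i : G * nat) := ball i.1 (i.2 + rad).
(* The event ranges over all admissible perturbations at once, so that avoiding it leaves room for
   the later scales. *)
pose bad (i : G * nat) (th : G -> A) := `[< exists sigma c, cayley_lip S L'%:R^-1 sigma /\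
   ((arc c).2 + eps) * (b i.2)%:R <
   \sum_(v <- ball i.1 i.2) (inarc (arc c).1 (arc c).2 (u v + phi th v + sigma v))%:R >].
(* Two arcs, at most [expR (c0 * X / 4)] codes, and probability at most [expR (- (c0 * X))] for
   each. *)
pose P (i : G * nat) : R := 2 * expR (- (c0 * (b i.2)%:R * 3 / 4)).
have bad_insens i c : c \notin Sev i -> insens c (bad i).
  move=> cS th x.
  have phiE v : v \in ball i.1 i.2 -> phi (upd th c x) v = phi th v.
    move=> vB; apply: (random_field_insens m0 L0); rewrite ltnNge; apply: contra cS => cv.
    rewrite mem_cayley_ball // (leq_trans (cayley_dist_triangle genS _ v _)) // leq_add //.
      by rewrite -mem_cayley_ball.
    by rewrite cayley_distC.
  have sumE sigma a l :
      \sum_(v <- ball i.1 i.2) (inarc a l (u v + phi (upd th c x) v + sigma v))%:R =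
      \sum_(v <- ball i.1 i.2) (inarc a l (u v + phi th v + sigma v))%:R :> R.
    by rewrite big_seq [RHS]big_seq; apply: eq_bigr => v /phiE ->.
  by apply: asbool_equiv_eq; split=> -[sigma [k [lip h]]]; exists sigma, k;
    rewrite sumE in h *.
have esP i : i \in es -> [/\ i.1 \in W, (n0 <= i.2)%N & (i.2 < N)%N].
  case/allpairsP => -[n g] [/=]; rewrite mem_index_iota mem_undup => /andP[? ?] ? ->.
  by split.
have badP i : i \in es -> Ex mu s0 (fun th => (bad i th)%:R) th0 <= P i.
  move=> /esP[iW n0i iN].
  have [k [sig' [kP netP]]] := cayley_lip_net (R := R) genS i.1 L' (leq_trans rn0 n0i) q0.
  pose e : R := q%:R^-1 + 8 * r%:R / L'%:R.
  have eP : e <= eps / 16.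
    have h : 8 * r%:R / L'%:R <= eps / 32.
      by rewrite mulrC -ler_pdivlMr // mulr_gt0.
    by rewrite /e; lra.
  have e_ge0 : 0 <= e by rewrite addr_ge0 ?divr_ge0 ?mulr_ge0.
  pose X : R := (b i.2)%:R.
  pose tm (Kc : {ffun 'I_k -> 'I_q}) c th : R := (((arc c).2 + eps) * X <= \sum_(v <- ball i.1 i.2)
    (inarc ((arc c).1 - e) ((arc c).2 + e) ((u v + sig' Kc v) + phi th v))%:R)%R%:R.
  have bad_le th : (bad i th)%:R <= \sum_Kc \sum_c tm Kc c th.
    have tm0 Kc c : 0 <= tm Kc c th by rewrite ler0n.
    rewrite /bad; case: asboolP => [[sigma [c [lip h]]]|_] /=; last first.
      by apply: sumr_ge0 => Kc _; apply: sumr_ge0.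
    have [Kc KcP] := netP sigma lip.
    rewrite (bigD1 Kc) //= (bigD1 c) //=.
    have -> : tm Kc c th = 1.
      rewrite /tm (le_trans (ltW h)) // big_seq [leRHS]big_seq; apply: ler_sum => v vB.
      case: (boolP (inarc _ _ _)) => //= hin.
      have := KcP v vB _ _ _ hin; rewrite -/e.
      by rewrite addrAC => ->.
    rewrite -addrA lerDl addr_ge0 //; first by apply: sumr_ge0.
    by apply: sumr_ge0 => K' _; apply: sumr_ge0.
  pose t : R := eps / (8 * D ^+ 3).
  have tail Kc c : Ex mu s0 (tm Kc c) th0 <= expR (- (c0 * X)).
    have t0 : 0 < t by rewrite divr_gt0 // mulr_gt0 // exprn_gt0.
    have tD3 : t * D ^+ 3 = eps / 8 by rewrite /t; field; rewrite gt_eqF.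
    have tD : t * D <= 2^-1.
      apply: (@le_trans _ _ (t * D ^+ 3)); last by rewrite tD3; lra.
      by rewrite ler_pM2l // exprS ler_peMr ?exprn_ege1 // ltW.
    have sub : {subset ball i.1 i.2 <= s0}.
      move=> v vB; rewrite mem_undup; apply/flattenP; exists (ball i.1 N : seq G).
        by apply/mapP; exists i.1.
      suff : v \in ball i.1 N by [].
      move: vB; rewrite !mem_cayley_ball // => h.
      by rewrite (leq_trans h) // ltnW.
    have le0 : 0 <= (arc c).2 + e by rewrite addr_ge0.
    have := @random_field_tail _ _ _ genS _ _ _ _ kappa0 m0 L0 _ s0_uniq (ball i.1 i.2) i.1 i.2
      ((arc c).1 - e) _ (fun v => u v + sig' Kc v) _ (((arc c).2 + eps) * X) th0 erefl sub le0 t0 tD.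
    move/le_trans; apply.
    rewrite ler_expR cardb -/X -/D -/rad.
    have dP : e + (m%:R^-1 + kappa + (1 + kappa) ^- J * D) <= eps / 4.
      by move: JP mP; rewrite -/rad -/(b rad) -/D mulrC /kappa => *; lra.
    have bn : (b (i.2 + rad))%:R <= X * D by rewrite -natrM ler_nat card_cayley_ballD.
    have X0 : 0 <= X by [].
    have h1 : t * (X * ((arc c).2 + e + (m%:R^-1 + kappa + (1 + kappa) ^- J * D))) <=
       t * (X * ((arc c).2 + eps / 4)).
      by rewrite ler_pM2l // ler_wpM2l // -addrA lerD2l.
    have h2 : 2 * (t ^+ 2 * D ^+ 2 * (b (i.2 + rad))%:R) <= t * X * eps / 4.
      apply: (@le_trans _ _ (2 * (t ^+ 2 * D ^+ 2 * (X * D)))).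
        by rewrite ler_pM2l // ler_wpM2l // mulr_ge0 ?sqr_ge0.
      have -> : 2 * (t ^+ 2 * D ^+ 2 * (X * D)) = 2 * t * X * (t * D ^+ 3) by ring.
      by rewrite tD3; lra.
    have c0E : c0 = t * eps / 2 by rewrite /c0 /t; field; rewrite gt_eqF.
    rewrite c0E; lra.
  apply: (le_trans (Ex_le mu_ge0 s0 th0 bad_le)).
  rewrite Ex_sum //.
  apply: (@le_trans _ _ (\sum_(Kc : {ffun 'I_k -> 'I_q}) 2 * expR (- (c0 * X)))).
    apply: ler_sum => Kc _; rewrite Ex_sum // big_bool /=.
    by have := tail Kc true; have := tail Kc false; lra.
  rewrite sumr_const card_ffun !card_ord -[leLHS]mulr_natl natrX /P mulrCA ler_wpM2l //.
  have qk : q%:R ^+ k <= expR (c0 * X / 4).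
    apply: (@le_trans _ _ (expR (k%:R * q%:R))).
      rewrite expRM_natl lerXn2r ?nnegrE ?expR_ge0 //.
      by apply: le_trans (expR_ge1Dx _); lra.
    rewrite ler_expR.
    have h1 : q%:R <= c0 / 4 * (b r)%:R.
      by move: rP; rewrite ler_pdivrMr //; lra.
    have h2 : k%:R * (b r)%:R <= X by rewrite -natrM ler_nat.
    apply: (@le_trans _ _ (k%:R * (c0 / 4 * (b r)%:R))); first by rewrite ler_wpM2l.
    have -> : k%:R * (c0 / 4 * (b r)%:R) = c0 / 4 * (k%:R * (b r)%:R) by ring.
    have -> : c0 * X / 4 = c0 / 4 * X by ring.
    by rewrite ler_wpM2l // divr_ge0 // ltW.
  apply: (@le_trans _ _ (expR (c0 * X / 4) * expR (- (c0 * X)))).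
    by rewrite ler_wpM2r ?expR_ge0.
  by rewrite -expRD ler_expR -/X; lra.
have Sev_neq0 i : i \in es -> Sev i != fset0.
  by move=> _; apply/fset0Pn; exists i.1; rewrite mem_cayley_ball // cayley_distxx.
have P_sum c : \sum_(i <- es | c \in Sev i) P i * (1 - eta) ^- #|` Sev i| <= eta.
  have bD n : (b (n + rad))%:R <= (b n)%:R * D.
    by rewrite -natrM ler_nat card_cayley_ballD.
  pose F n : R := 2 * expR (- (c0 * (b n)%:R / 2)).
  have PF i : P i * (1 - eta) ^- #|` Sev i| <= F i.2.
    rewrite etaE -expRM_natl -expRN /P /F -mulrA ler_pM2l // -expRD ler_expR.
    rewrite cardb; have := bD i.2; set X := (b i.2)%:R; set Y := (b (_ + _))%:R => YX.
    have : Y * (c0 / (4 * D)) <= c0 * X / 4.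
      have -> : c0 * X / 4 = (X * D) * (c0 / (4 * D)) by field; rewrite gt_eqF.
      by rewrite ler_wpM2r // divr_ge0 ?(ltW c00) // mulr_ge0 // ltW.
    by rewrite mulrN; lra.
  have F0 n : 0 <= F n by rewrite mulr_ge0 ?expR_ge0.
  apply: (@le_trans _ _ (\sum_(i <- es | c \in Sev i) F i.2)).
    by apply: ler_sum => i _; exact: PF.
  rewrite big_mkcond big_allpairs_dep /=.
  apply: (@le_trans _ _ (\sum_(n0 <= n < N) K * (n%:R^-1 - n.+1%:R^-1))).
    rewrite big_seq [leRHS]big_seq; apply: ler_sum => n.
    rewrite mem_index_iota => /andP[n0n _].
    have -> : \sum_(g <- undup W) (if c \in Sev (g, n) then F n else 0) =
        F n * (count (fun g => c \in Sev (g, n)) (undup W))%:R.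
      rewrite -(sumr_bool R) mulr_sumr; apply: eq_bigr => g _.
      by case: ifP => _; rewrite ?mulr1 ?mulr0.
    (* The events of radius [n] that involve [c] are centred within [n + rad] of it. *)
    apply: (@le_trans _ _ (F n * ((b n)%:R * D))).
      rewrite ler_wpM2l // (le_trans _ (bD n)) // ler_nat -(cardb c).
      apply: count_leq_card; first exact: undup_uniq.
      by move=> g; rewrite /Sev !mem_cayley_ball //= cayley_distC.
    have -> : F n * ((b n)%:R * D) = 2 * D * ((b n)%:R * expR (- (c0 * (b n)%:R / 2))).
      by rewrite /F; ring.
    rewrite /K -[leRHS]mulrA ler_wpM2l ?mulr_ge0 ?(ltW D0) //.
    by apply: expR_decay => //; rewrite (leq_trans n00 n0n) b_gt.
  rewrite -mulr_sumr; have [Nn0|n0N] := leqP N n0.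
    by rewrite big_geq // mulr0 ltW.
  apply: le_trans Kn0; rewrite ler_pM2l //.
  under eq_bigr do rewrite -opprB; rewrite sumrN telescope_sumr ?(ltnW n0N) //.
  by rewrite opprB lerBlDr lerDl invr_ge0.
have eta01 : 0 <= eta < 1 by rewrite ltW.
have [th thP] := avoid_bad_events mu_ge0 mu_sum1 bad_insens badP Sev_neq0 eta01 P_sum.
exists (phi th); first exact: random_field_lip.
move=> g n gW nN sigma lip c.
have ies : (g, n) \in es.
  by apply/allpairsP; exists (n, g); rewrite mem_index_iota mem_undup nN gW.
rewrite -/ball cardb leNgt; apply: contra (thP _ ies) => h.
by apply/asboolP; exists sigma, c.
Qed.

(** * Cylinders, compactness and translation of balls *)

Lemma nbhs_cylinder (T : eqType) (x : {ptws T -> bool}) (s : seq T) :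
  nbhs x [set y : {ptws T -> bool} | {in s, y =1 x}].
Proof.
elim: s => [|v s IH]; first by apply: filterS filterT.
have h : nbhs x [set y : {ptws T -> bool} | y v = x v].
  exact: (@proj_continuous T (fun=> bool) v x [set x v] (discrete_set1 _)).
apply: filterS (filterI h IH) => y [yv ys] w.
by rewrite inE => /orP[/eqP ->|/ys].
Qed.

Lemma closed_cylinder (T : eqType) (Q : set {ptws T -> bool}) (s : seq T) :
  (forall x y : {ptws T -> bool}, {in s, y =1 x} -> Q y -> Q x) -> closed Q.
Proof. by move=> QP x /(_ _ (nbhs_cylinder x s))[y [/QP Qyx /Qyx]]. Qed.

(** By Tychonoff, the filter generated by the [C i] has a cluster point, which lies in each of these
    closed sets. *)
Lemma ptws_bool_bigcap_neq0 (T : eqType) (I : choiceType) (D : set I)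
    (C : I -> set {ptws T -> bool}) :
  (forall i, closed (C i)) -> finI D C -> \bigcap_(i in D) C i !=set0.
Proof.
move=> clC finIC.
have cpt := @tychonoff T (fun=> bool) (fun=> setT) (fun=> bool_compact).
have [|p [_ clp]] := cpt _ (finI_filter finIC).
  by exists (\bigcap_(i in [set` fset0]) C i); first by exists fset0.
exists p => i Di; apply: clC => B; apply: clp.
by exists (C i); first exact: finI_from1.
Qed.

Lemma dens_sum (R : realType) (G : groupType) (F : {fset G}) (x : G -> bool) :
  dens R true F x = \sum_(v <- F) (x v)%:R / #|` F|%:R.
Proof.
rewrite /dens -mulr_suml card_fset_sum1 big_fset /= natr_sum; congr (_ / _).
by rewrite big_mkcond; apply: eq_bigr => v _; rewrite eqb_id; case: (x v).
Qed.

Lemma sum_cayley_ball_shift (R : realType) (G : groupType) (S : {fset G}) (g h : G) n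
    (F : G -> R) : generates S ->
  \sum_(v <- cayley_ball S h n) F (g^-1 * v)%g = \sum_(v <- cayley_ball S (g^-1 * h)%g n) F v.
Proof.
move=> genS; rewrite -(big_map (fun v => g^-1 * v)%g predT F) /=; apply: perm_big.
apply: uniq_perm; rewrite ?map_inj_uniq ?fset_uniq //; first exact: mulgI.
move=> w; apply/mapP/idP => [[v vB ->]|].
  rewrite mem_cayley_ball // cayley_dist_mul //.
  by rewrite -(mem_cayley_ball genS).
rewrite mem_cayley_ball // => wB; exists (g * w)%g; last by rewrite mulKg.
suff : (g * w)%g \in cayley_ball S h n by [].
by rewrite mem_cayley_ball // -(cayley_dist_mul genS g^-1) mulKg.
Qed.

(** * Iteration over scales and the subshift *)

Theorem corollary3p3 (R : realType) (G : groupType)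
    (hfg : finitely_generated G)
    (hinf : infinite_set [set: G])
    (hgrowth : subexponential_growth R G)
    (S : {fset G}) (hS : generates S)
    (alpha : R) (halpha : 0 <= alpha <= 1) :
  exists X : set {ptws G -> bool},
    [/\ subshift X, X !=set0 & uniform_density S X alpha].
Proof.
pose ball := cayley_ball S.
pose eps (k : nat) : R := k.+1%:R^-1.
have epsP k : 0 < eps k <= 1 by rewrite invr_gt0 ltr0n invf_le1 ?ltr0n // ler1n.
(* Upper bounds for an arc and its complement together give a two-sided bound on the density. *)
pose arc (c : bool) : R * R := if c then (0, alpha) else (alpha, 1 - alpha).
have arc0 c : 0 <= (arc c).2 by case/andP: halpha => a0 a1; case: c => //=; rewrite subr_ge0.
have steps (kL : nat * nat) : exists p : nat * nat, (0 < kL.2)%N -> (0 < p.1)%N /\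
    forall (W : seq G) N (u : G -> R),
    exists2 phi, cayley_lip S kL.2%:R^-1 phi &
    forall g n, g \in W -> (p.2 <= n < N)%N ->
    forall sigma, cayley_lip S p.1%:R^-1 sigma -> forall c,
      \sum_(v <- ball g n) (inarc (arc c).1 (arc c).2 (u v + phi v + sigma v))%:R
      <= ((arc c).2 + eps kL.1) * #|` ball g n|%:R.
  case: (posnP kL.2) => [->|L0]; first by exists (0%N, 0%N).
  have [L' [n0 [L'0 h]]] := equidistribution_step hS hinf hgrowth (epsP kL.1) L0.
  by exists (L', n0) => _; split=> // W N u; exact: h.
have [f fP] := choice steps.
(* The maximum makes later fields admissible perturbations at level [k']; the factor 2 leaves room
   for the sum of all of them. *)
pose fix Ls k : nat := if k is k'.+1 then (2 * maxn (Ls k') (f (k', Ls k')).1)%N else 1%N.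
pose Ns k := (f (k, Ls k)).2.
have Ls_gt0 k : (0 < Ls k)%N by elim: k => //= k IH; rewrite muln_gt0 leq_max IH.
(* After [phi] is fixed at level [j], the sum [psi] of the later fields serves both as its
   perturbation and as the solution over the base [u + phi]. *)
have iter (W : seq G) N K j (u : G -> R) : exists2 psi, cayley_lip S (2 / (Ls j)%:R) psi &
    forall k, (j <= k < j + K)%N -> forall g n, g \in W -> (Ns k <= n < N)%N -> forall c,
      \sum_(v <- ball g n) (inarc (arc c).1 (arc c).2 (u v + psi v))%:R
      <= ((arc c).2 + eps k) * #|` ball g n|%:R.
  elim: K j u => [|K IH] j u.
    exists (fun=> 0); last by move=> k; lia.
    by apply: cayley_lip0; rewrite divr_ge0.
  have [L'0 /(_ W N u)[phi phiL phiP]] := fP (j, Ls j) (Ls_gt0 j).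
  have [psi psiL psiP] := IH j.+1 (fun v => u v + phi v).
  have LsS : 2 / (Ls j.+1)%:R = (maxn (Ls j) (f (j, Ls j)).1)%:R^-1 :> R.
    rewrite /= natrM invfM mulrA divff ?mul1r // ; lra.
  exists (fun v => phi v + psi v).
    have -> : 2 / (Ls j)%:R = (Ls j)%:R^-1 + (Ls j)%:R^-1 :> R by rewrite mulrDl mul1r.
    apply: cayley_lipD => //; apply: cayley_lip_le psiL; rewrite LsS.
    by rewrite lef_pV2 ?posrE ?ltr0n ?ler_nat ?leq_max ?Ls_gt0 ?leqnn.
  move=> k jk g n gW nN c; under eq_bigr do rewrite addrA.
  have [kj|jk1] := leqP k j; last by apply: psiP => //; lia.
  have {kj jk} kj : k = j by lia.
  rewrite {k}kj in nN *; apply: phiP => //.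
  apply: cayley_lip_le psiL; rewrite LsS.
  by rewrite lef_pV2 ?posrE ?ltr0n ?ler_nat ?leq_max ?Ls_gt0 ?leqnn ?orbT.
pose C (i : nat * G * nat) : set {ptws G -> bool} :=
  [set x | `|dens R true (ball i.1.2 i.2) x - alpha| <= eps i.1.1].
pose I : set (nat * G * nat) := [set i | (Ns i.1.1 <= i.2)%N].
have Cclosed i : closed (C i).
  apply: (@closed_cylinder _ _ (ball i.1.2 i.2)) => x y xy; rewrite /C /=.
  suff -> : dens R true (ball i.1.2 i.2) x = dens R true (ball i.1.2 i.2) y by [].
  by rewrite !dens_sum big_seq [RHS]big_seq; apply: eq_bigr => v /xy ->.
exists (\bigcap_(i in I) C i); split.
- split; first by apply: closed_bigI.
  move=> g x Xx [[k h] n] Ii; have := Xx (k, g^-1 * h, n)%g Ii.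
  rewrite /C /= !dens_sum -!mulr_suml -(sum_cayley_ball_shift g h n (fun v => (x v)%:R) hS).
  by rewrite !(card_cayley_ball hS).
- apply: ptws_bool_bigcap_neq0 => //.
  move=> D DI.
  (* Finitely many constraints involve finitely many centres, radii and levels, which [iter] handles
     together. *)
  pose N := (\max_(i <- D) i.2).+1; pose K := (\max_(i <- D) i.1.1).+1.
  have [psi _ psiP] := iter [seq i.1.2 | i <- D] N K 0%N (fun=> 0).
  exists (fun v => inarc 0 alpha (psi v)) => i iD.
  have iI : I i by have := DI i iD; rewrite inE.
  have iK : (0 <= i.1.1 < 0 + K)%N.
    by rewrite add0n ltnS /=; exact: (leq_bigmax_seq i).
  have iN : (Ns i.1.1 <= i.2 < N)%N.
    by rewrite iI ltnS; exact: (leq_bigmax_seq i).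
  have bound := psiP _ iK i.1.2 i.2 (map_f _ iD) iN.
  rewrite /C /= dens_sum -mulr_suml.
  set B := ball _ _ in bound *.
  have B0 : 0 < #|` B|%:R :> R.
    by rewrite ltr0n (card_cayley_ball hS) card_cayley_ball_gt0.
  have {}bound c : \sum_(v <- B) (inarc (arc c).1 (arc c).2 (psi v))%:R <=
      ((arc c).2 + eps i.1.1) * #|` B|%:R.
    by apply: le_trans (bound c); apply: ler_sum => v _; rewrite add0r.
  have /= upper := bound true; have /= lower := bound false.
  (* The two arcs cover the circle, so the upper bound for the second yields the lower bound for the
     first. *)
  have compl : #|` B|%:R <= \sum_(v <- B) (inarc 0 alpha (psi v))%:R +
      \sum_(v <- B) (inarc alpha (1 - alpha) (psi v))%:R :> R.
    rewrite card_fset_sum1 natr_sum -big_split /=; apply: ler_sum => v _.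
    case: (boolP (inarc 0 alpha (psi v))) => [_|]; first by rewrite lerDl.
    rewrite /inarc subr0 -leNgt => av.
    have -> : frac (psi v - alpha) = frac (psi v) - alpha.
      rewrite -[RHS]frac_id; last by have := frac_lt1 (psi v); case/andP: halpha; lra.
      rewrite -(fracDz (frac (psi v) - alpha) (Num.floor (psi v))); congr frac.
      by rewrite /frac; ring.
    by rewrite ltrD2r frac_lt1 add0r.
  rewrite ler_norml; apply/andP; split.
    by rewrite lerBrDl ler_pdivlMr //; lra.
  by rewrite lerBlDl ler_pdivrMr.
- move=> x Xx g; apply/cvgrPdist_le => e e0.
  have [k _ kP] := near_infty_natSinv_lt (PosNum e0).
  (* Constraints of level [k] hold at every centre for all radii from [Ns k] on, hence along any
     sequence [g]. *)
  exists (Ns k) => // n nk /=; rewrite distrC.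
  exact: le_trans (Xx (k, g n, n) nk) (ltW (kP k (leqnn k))).
Qed.
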